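(* (Multiterm maximum principle, strong solutions.) Let $T>0$, let $\ell$ be a positive integer, $0<\alpha_\ell<\dots<\alpha_2<\alpha_1\le1$, and let $q_i:[0,T]\to\mathbb{R}$ satisfy $q_i(t)\ge0$, $i=1,\dots,\ell$, and $\sum_{i=1}^\ell q_i(t)\ge C_q>0$ for all $t\in[0,T]$. Let $\Omega\subset\mathbb{R}^d$, $d\in\{1,2,3\}$, be a bounded Lipschitz domain and let $\mathcal{L}u:=-\sum_{i,j=1}^d\partial_{x_i}(a_{ij}(x,t)\,\partial_{x_j}u)+\sum_{i=1}^d b_i(x,t)\,\partial_{x_i}u$, where $\{a_{ij}(x,t)\}$ is symmetric positive definite for every $(x,t)\in\Omega\times(0,T]$ and, for each $t\in(0,T]$, $a_{ij}(\cdot,t)\in C^1(\Omega)$, $b_i(\cdot,t)\in C(\Omega)$, $c(\cdot,t)\in C(\Omega)$. Let $c(x,t)\ge-\lambda$ for all $(x,t)\in\Omega\times(0,T]$ with some constant $\lambda\ge0$. Suppose that $u(x,0)\le0$ for all $x\in\Omega$ and $u(x,t)\le0$ for all $(x,t)\in\partial\Omega\times[0,T]$, and also $u\in C(\bar\Omega\times[0,T])$, $u(\cdot,t)\in C^2(\Omega)$ for any $t\in(0,T]$, and $u(x,\cdot)\in W^{1,\infty}(\epsilon,t)$ for any $x\in\Omega$ and $0<\epsilon<t\le T$; if $\alpha_1=1$, suppose additionally that $u(x,\cdot)\in C^1(0,T]$ for any $x\in\Omega$. Then $$\sum_{i=1}^\ell q_i(t)\,D_t^{\alpha_i}u(x,t)+\mathcal{L}u(x,t)+c(x,t)\,u(x,t)\le0\quad\text{in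 }\Omega\times(0,T]$$ implies $u\le0$ in $\bar\Omega\times[0,T]$.
   Context: For $\alpha\in(0,1)$, $D_t^\alpha$ is the Caputo derivative $D_t^\alpha u(\cdot,t):=\frac{1}{\Gamma(1-\alpha)}\int_0^t(t-s)^{-\alpha}\,\partial_s u(\cdot,s)\,ds$, $t>0$, with the integral understood as $\lim_{\epsilon\to0^+}\int_\epsilon^t$ (which exists for $u$ of the stated regularity); $D_t^1:=\partial_t$. $C^1(0,T]$ denotes functions continuously differentiable on $(0,T]$ (one-sided at $T$). *)

(* Defs.v *)
(* MathComp + MathComp-Analysis *)
From HB Require Import structures.
From mathcomp Require Import all_boot all_order all_algebra.
From mathcomp Require Import all_classical all_reals all_analysis.

Set Implicit Arguments.
Unset Strict Implicit.
Unset Printing Implicit Defensive.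

Import Order.TTheory GRing.Theory Num.Theory.
Import numFieldNormedType.Exports.

Local Open Scope classical_set_scope.
Local Open Scope ring_scope.

(** * Functions of time *)

(* Euler's Gamma function; the integral converges for [0 < z]. *)
Definition Gamma (R : realType) (z : R) : R :=
  \int[lebesgue_measure]_(s in `]0, +oo[) (s `^ (z - 1) * expR (- s)).

(* [C_c^oo(a, b)], each function being extended by zero to the whole line. *)
Definition test_function (R : realType) (a b : R) (phi : R -> R) : Prop :=
  (forall k (s : R), derivable (derive1n k phi) s 1) /\
  exists K : set R,
    [/\ compact K, K `<=` `]a, b[ & forall s, ~ K s -> phi s = 0].

(* [L^oo(a, b)], through extension by zero outside [(a, b)]. *)
Definition Loo (R : realType) (a b : R) (g : R -> R) : Prop :=
  g \_ `]a, b[ \in Lfun (lebesgue_measure : set R -> \bar R) +oo%E.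

(* [g], in [L^oo(a, b)], is the distributional derivative of [v] there. *)
Definition is_weak_deriv (R : realType) (a b : R) (v g : R -> R) : Prop :=
  Loo a b g /\
  forall phi : R -> R, test_function a b phi ->
    \int[lebesgue_measure]_(s in `]a, b[) (v s * derive1 phi s) =
    - \int[lebesgue_measure]_(s in `]a, b[) (g s * phi s).

(* The Sobolev space [W^{1,oo}(a, b)]. *)
Definition W1oo (R : realType) (a b : R) (v : R -> R) : Prop :=
  Loo a b v /\ exists g : R -> R, is_weak_deriv a b v g.

(* A representative of the weak derivative of [v] in [W^{1,oo}(a, b)]. Two
   representatives agree almost everywhere on [(a, b)], so integrals over
   [(a, b)] do not depend on the choice. *)
Definition weak_deriv (R : realType) (a b : R) (v : R -> R) : R -> R :=
  xget (cst 0) [set g | is_weak_deriv a b v g].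

(* The Caputo derivative of order [0 < alpha < 1] at [t > 0], the integral over
   [(0, t)] being the limit of the integrals over [(e, t)] as [e] tends to 0
   from the right. *)
Definition caputo (R : realType) (alpha : R) (v : R -> R) (t : R) : R :=
  (Gamma (1 - alpha))^-1 *
  lim ((\int[lebesgue_measure]_(s in `]e, t[)
          ((t - s) `^ (- alpha) * weak_deriv e t v s)) @[e --> 0^'+]).

(* The difference quotient only uses times in [(0, T]]: it gives the ordinary
   derivative at [0 < t < T] and the one-sided (left) derivative at [T]. *)
Definition diff_quot (R : realType) (v : R -> R) (t s : R) : R :=
  (s - t)^-1 * (v s - v t).

Definition time_deriv (R : realType) (T : R) (v : R -> R) (t : R) : R :=
  lim (diff_quot v t s @[s --> within `]0, T] t^']).

(* [C^1(0, T]] *)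
Definition C1_time (R : realType) (T : R) (v : R -> R) : Prop :=
  (forall t : R, t \in `]0, T] ->
     cvg (diff_quot v t s @[s --> within `]0, T] t^'])) /\
  {within `]0, T], continuous (time_deriv T v)}.

(* [D_t^alpha] on [(0, T]] for [0 < alpha <= 1] *)
Definition Dt (R : realType) (T alpha : R) (v : R -> R) (t : R) : R :=
  if alpha == 1 then time_deriv T v t else caputo alpha v t.

(** * Functions of space *)

Definition partial (R : realType) (n : nat) (i : 'I_n.+1)
    (f : 'rV[R]_n.+1 -> R) (x : 'rV[R]_n.+1) : R :=
  'D_(delta_mx 0 i) f x.

(* [C^k(Omega)] for an open set [Omega] *)
Fixpoint Ck (R : realType) (n : nat) (k : nat) (Omega : set 'rV[R]_n.+1)
    (f : 'rV[R]_n.+1 -> R) : Prop :=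
  (forall x, Omega x -> {for x, continuous f}) /\
  match k with
  | 0 => True
  | k'.+1 => forall i : 'I_n.+1,
      (forall x, Omega x -> derivable f x (delta_mx 0 i)) /\
      Ck k' Omega (partial i f)
  end.

Definition boundary (X : topologicalType) (A : set X) : set X :=
  closure A `\` A^°.

(* Near each boundary point, after an orthogonal change of coordinates
   [y = x Q], the set is the region strictly above the graph of a Lipschitz
   function of the coordinates other than the first one. *)
Definition lipschitz_boundary (R : realType) (n : nat)
    (Omega : set 'rV[R]_n.+1) : Prop :=
  forall x0, boundary Omega x0 ->
  exists (Q : 'M[R]_n.+1) (gamma : 'rV[R]_n -> R) (U : set 'rV[R]_n.+1),
    [/\ Q *m Q^T = 1%:M,
        lipschitz gamma,
        nbhs x0 U &
        forall x, U x ->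
          (Omega x <-> gamma (col' ord0 (x *m Q)) < (x *m Q) 0 ord0)].

Definition bounded_lipschitz_domain (R : realType) (n : nat)
    (Omega : set 'rV[R]_n.+1) : Prop :=
  [/\ Omega !=set0, open Omega, connected Omega, bounded_set Omega &
      lipschitz_boundary Omega].

Definition sym_posdef (R : realType) (n : nat) (A : 'M[R]_n) : Prop :=
  A^T = A /\ forall xi : 'rV[R]_n, xi != 0 -> 0 < (xi *m A *m xi^T) 0 0.

(* [u x t] is the value at the point [x] and the time [t]. *)
Definition elliptic_op (R : realType) (n : nat)
    (a : 'rV[R]_n.+1 -> R -> 'M[R]_n.+1) (b : 'rV[R]_n.+1 -> R -> 'rV[R]_n.+1)
    (u : 'rV[R]_n.+1 -> R -> R) (x : 'rV[R]_n.+1) (t : R) : R :=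
  - (\sum_i \sum_j
       partial i (fun y => a y t i j * partial j (fun z => u z t) y) x)
  + \sum_i b x t 0 i * partial i (fun z => u z t) x.

(* Main.v *)
Require Import Defs.
From HB Require Import structures.
From mathcomp Require Import all_boot all_order all_algebra.
From mathcomp Require Import all_classical all_reals all_analysis.
From mathcomp Require Import measurable_realfun ess_sup_inf ring lra.
Import Order.TTheory GRing.Theory Num.Theory.
Import numFieldNormedType.Exports.
Local Open Scope classical_set_scope.
Local Open Scope ring_scope.

Set Implicit Arguments.
Unset Strict Implicit.
Unset Printing Implicit Defensive.

(** Suppose that [u] is positive somewhere, and maximise
    [expR (- (t / d)) * u x t] over the compact set of all [x] in
    [closure Omega] and [t] in [0, T], for a small time scale [d > 0]. The sign
    conditions on the initial and the lateral values put a maximiser at some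
    [xs] inside [Omega] and some [ts > 0], and [u xs ts > 0]. At that point the
    left-hand side of the differential inequality is positive, for the
    following reasons.

    In space, [u] has an interior maximum at [xs], so its gradient vanishes and
    its Hessian is a nonpositive form; as the contraction of a positive definite
    matrix with such a form is nonpositive ([posdef_frobenius_le0]), the
    elliptic operator is nonnegative ([elliptic_op_ge0_at_max]).

    In time, the weight yields
    [u xs s <= expR (- ((ts - s) / d)) * u xs ts] for [s <= ts]: the past values
    never exceed the present one, and those older than [d] do not exceed half of
    it. Hence each derivative of order [alpha] is at least
    [gain alpha d * u xs ts] ([Dt_ge_at_max]), where [gain alpha d] tends to
    infinity as [d] tends to 0 ([gain_unbounded]). Since the [q i] add up to at
    least [Cq], a small [d] makes the sum of the time derivatives larger than
    [lambda * u xs ts], while the reaction term is at least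
    [- lambda * u xs ts]. The weight is there for the classical derivative
    ([alpha = 1]), which is merely nonnegative at a maximum of [u] itself.

    The bound on the Caputo derivative comes from an integration by parts
    ([caputo_integral_by_parts]),
    [int_e^t (t - s)^(- alpha) v'(s) ds = (t - e)^(- alpha) (v t - v e)
      + int_e^t alpha (t - r)^(- alpha - 1) (v t - v r) dr],
    whose right-hand side involves only values of [v] and is a sum of
    nonnegative terms when [v t] is a maximum. It also shows that the limit as
    [e] tends to 0 exists. Since [v'] is only a distributional derivative, the
    formula is proved in two steps: testing against smooth plateau functions
    that approximate the indicator of an interval gives
    [int_r^t v' = v t - v r] ([weak_FTC]), and Fubini's theorem then moves the
    derivative onto the kernel ([Rintegral_kernel_by_parts]). *)

(** * The elliptic operator at an interior maximum *)

(** Induction on the size. With [p] the first diagonal entry, [A] is the rank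
    one matrix [A_0i A_0j / p] plus its Schur complement [S], which lives on the
    remaining indices; the former contracts [H] to one value of its quadratic
    form, and [S] is again positive definite. *)
Lemma posdef_frobenius_le0 (R : realFieldType) (n : nat) (A H : 'I_n -> 'I_n -> R) :
  (forall i j, A i j = A j i) ->
  (forall x : 'I_n -> R, (exists i, x i != 0) ->
     0 < \sum_i \sum_j x i * A i j * x j) ->
  (forall x : 'I_n -> R, \sum_i \sum_j x i * H i j * x j <= 0) ->
  \sum_i \sum_j A i j * H i j <= 0.
Proof.
elim: n A H => [|n IHn] A H symA posA negH; first by rewrite big_ord0.
pose p := A ord0 ord0.
have p0 : 0 < p.
  have := posA (fun i => (i == ord0)%:R).
  rewrite big_ord_recl [X in _ + X]big1 ?addr0; last first.
    by move=> i _; apply: big1 => j _; rewrite !mul0r.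
  rewrite big_ord_recl [X in _ + X]big1 ?addr0 /=; last first.
    by move=> i _; rewrite mulr0.
  rewrite mul1r mulr1; apply; exists ord0; by rewrite eqxx oner_eq0.
pose S i j := A i j - A ord0 i * A ord0 j / p.
have S0l j : S ord0 j = 0 by rewrite /S mulrAC divff ?gt_eqF// mul1r subrr.
have S0r i : S i ord0 = 0.
  by rewrite /S mulfK ?gt_eqF// (symA i) subrr.
have split_sum (F : 'I_n.+1 -> 'I_n.+1 -> R) :
    \sum_i \sum_j A i j * F i j =
    p^-1 * (\sum_i \sum_j A ord0 i * A ord0 j * F i j)
    + \sum_i \sum_j S (lift ord0 i) (lift ord0 j) * F (lift ord0 i) (lift ord0 j).
  transitivity (\sum_i \sum_j p^-1 * (A ord0 i * A ord0 j * F i j)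
     + \sum_i \sum_j S i j * F i j).
    rewrite -big_split/=; apply: eq_bigr => i _; rewrite -big_split/=.
    by apply: eq_bigr => j _; rewrite /S; ring.
  congr (_ + _).
    rewrite mulr_sumr; apply: eq_bigr => i _.
    by rewrite mulr_sumr; apply: eq_bigr.
  rewrite big_ord_recl [X in X + _]big1 ?add0r; last first.
    by move=> j _; rewrite S0l mul0r.
  by apply: eq_bigr => i _; rewrite big_ord_recl S0r mul0r add0r.
rewrite split_sum -[leRHS]addr0; apply: lerD.
  apply: mulr_ge0_le0; first by rewrite invr_ge0 ltW.
  have := negH (A ord0); congr (_ <= _); apply: eq_bigr => i _; apply: eq_bigr => j _.
  by rewrite mulrAC.
apply: (IHn (fun i j => S (lift ord0 i) (lift ord0 j))
            (fun i j => H (lift ord0 i) (lift ord0 j))).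
- by move=> i j; rewrite /S symA [A ord0 (lift ord0 i) * _]mulrC.
- move=> x [i xi0].
  (* The value of the first coordinate that minimises the form of [A], given the
     others: there the form of [A] equals that of [S]. *)
  pose x0 := - (\sum_j A ord0 (lift ord0 j) * x j) / p.
  pose y (i : 'I_n.+1) := if unlift ord0 i is Some k then x k else x0.
  have y0 : y ord0 = x0 by rewrite /y unlift_none.
  have yS k : y (lift ord0 k) = x k by rewrite /y liftK.
  have Ay : \sum_i A ord0 i * y i = 0.
    rewrite big_ord_recl y0; under eq_bigr do rewrite yS.
    by rewrite /x0 mulrC divfK ?gt_eqF// addNr.
  have /posA : exists k, y k != 0 by exists (lift ord0 i); rewrite yS.
  have -> : \sum_i0 \sum_j y i0 * A i0 j * y j =
     \sum_i0 \sum_j A i0 j * (y i0 * y j).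
    by apply: eq_bigr => i1 _; apply: eq_bigr => j _; rewrite mulrAC mulrC.
  rewrite (split_sum (fun i j => y i * y j)).
  have -> : \sum_i0 \sum_j A ord0 i0 * A ord0 j * (y i0 * y j) =
            (\sum_i0 A ord0 i0 * y i0) * (\sum_i0 A ord0 i0 * y i0).
    rewrite mulr_suml; apply: eq_bigr => i1 _; rewrite mulr_sumr.
    by apply: eq_bigr => j _; ring.
  rewrite Ay mul0r mulr0 add0r.
  congr (_ < _); apply: eq_bigr => i1 _; apply: eq_bigr => j _; rewrite !yS; ring.
- move=> x.
  pose y (i : 'I_n.+1) := if unlift ord0 i is Some k then x k else 0.
  have y0 : y ord0 = 0 by rewrite /y unlift_none.
  have yS k : y (lift ord0 k) = x k by rewrite /y liftK.
  have := negH y; rewrite big_ord_recl [X in X + _]big1 ?add0r; last first.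
    by move=> j _; rewrite y0 !mul0r.
  congr (_ <= _); apply: eq_bigr => i _.
  rewrite big_ord_recl y0 mulr0 add0r; apply: eq_bigr => j _.
  by rewrite !yS.
Qed.

Lemma is_derive_along (R : realType) (V : normedModType R) (f : V -> R)
    (y w : V) (s d : R) :
  is_derive (y + s *: w) w f d ->
  is_derive s (1 : R) (fun r : R => f (y + r *: w)) d.
Proof.
have E : (fun k : R => k^-1 *: (f (k *: w + (y + s *: w)) - f (y + s *: w)))
   = (fun k : R => k^-1 *: (f (y + (k *: 1 + s) *: w) - f (y + s *: w))).
  apply/funext => k; congr (_ *: (f _ - _)).
  by rewrite [k *: 1]mulr1 scalerDl addrCA.
move=> [d1 d2]; apply: DeriveDef.
  by move: d1; rewrite /derivable /= E.
by rewrite /derive /= -E; exact: d2.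
Qed.

(** The mean value theorem on the segment from [y] to [y + h *: w], for either
    sign of [h]. *)
Lemma increment_along (R : realType) (V : normedModType R) (f : V -> R) (w y : V) (h : R) :
  (forall s : R, `|s| <= `|h| -> derivable f (y + s *: w) w) ->
  exists2 s : R, `|s| <= `|h| & f (y + h *: w) - f y = h * 'D_w f (y + s *: w).
Proof.
move=> df.
pose phi (s : R) := f (y + s *: w).
have dphi (s : R) : `|s| <= `|h| -> is_derive s (1 : R) phi ('D_w f (y + s *: w)).
  by move=> sh; apply: is_derive_along; exact/derivableP/df.
have cphi a b : (forall s, s \in `[a, b] -> `|s| <= `|h|) -> {within `[a, b], continuous phi}.
  move=> ab; apply: derivable_within_continuous => s sab.
  by have [] := dphi s (ab s sab).
have [h0|h0] := leP 0 h.
- have sh s : s \in `[0, h] -> `|s| <= `|h|.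
    by rewrite in_itv/= => /andP[s0 ?]; rewrite !ger0_norm.
  have [||s s0h E] := @MVT_segment R phi (fun s => 'D_w f (y + s *: w)) 0 h h0.
  + by move=> s s0h; apply: dphi; apply: sh; exact: subset_itv_oo_cc.
  + exact: cphi.
  exists s; first exact: sh.
  by move: E; rewrite /phi scale0r addr0 subr0 mulrC.
- have sh s : s \in `[h, 0] -> `|s| <= `|h|.
    by rewrite in_itv/= => /andP[s0 ?]; rewrite !ler0_norm ?lerN2 // ltW.
  have [||s s0h E] := @MVT_segment R phi (fun s => 'D_w f (y + s *: w)) h 0 (ltW h0).
  + by move=> s s0h; apply: dphi; apply: sh; exact: subset_itv_oo_cc.
  + exact: cphi.
  exists s; first exact: sh.
  by move: E; rewrite /phi scale0r addr0 sub0r => E; rewrite -opprB E; ring.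
Qed.

(** Moving first along [v] and then along [c *: w], the second increment is a
    derivative in the direction [w] at a nearby point, by the mean value theorem.
    This needs continuity of only one of the two directional derivatives, so
    that directions can be added one at a time. *)
Lemma is_derive_direction_add (R : realType) (V : normedModType R) (f : V -> R)
    (x v w : V) (c d : R) :
  is_derive x v f d ->
  (\forall y \near x, derivable f y w) ->
  {for x, continuous ('D_w f)} ->
  is_derive x (v + c *: w) f (d + c * 'D_w f x).
Proof.
move=> [dv dvE] dw cw.
suff q : h^-1 *: (f (h *: (v + c *: w) + x) - f x) @[h --> 0^'] --> d + c * 'D_w f x.
  by apply: DeriveDef; [apply: cvgP q | apply: cvg_lim q].
have qv : h^-1 *: (f (h *: v + x) - f x) @[h --> 0^'] --> d by rewrite -dvE; exact: dv.
rewrite (_ : (fun h : R => _) = (fun h : R => h^-1 *: (f (h *: v + x) - f x)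
   + h^-1 *: (f (h *: v + x + (h * c) *: w) - f (h *: v + x)))); last first.
  apply/funext => h; rewrite -scalerDr [h *: (v + _)]scalerDr scalerA; congr (_ *: _).
  by rewrite [RHS]addrC subrKA addrAC.
apply: cvgD => //.
apply/cvgrPdist_le => e e0.
have c1 : 0 < `|c| + 1 by rewrite ltr_pwDr.
have /cvgrPdist_le /(_ (e / (`|c| + 1))) := cw.
rewrite divr_gt0// => /(_ isT) cwe.
have /nbhs_ballP[r /= r0 rP] : \forall y \near x, derivable f y w /\
   `|'D_w f x - 'D_w f y| <= e / (`|c| + 1) by near=> y; split; near: y.
have K0 : 0 < `|v| + `|c| * `|w| + 1 by rewrite ltr_pwDr// addr_ge0// mulr_ge0.
near=> h.
have hne : h != 0 by near: h; exact: nbhs_dnbhs_neq.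
have hr : `|h| < r / (`|v| + `|c| * `|w| + 1).
  near: h; apply: dnbhs0_lt; exact: divr_gt0.
have hb s : `|s| <= `|h * c| -> ball x r (h *: v + x + s *: w).
  move=> sh; rewrite -ball_normE /ball_/= -normrN opprB addrAC addrK.
  rewrite (le_lt_trans (ler_normD _ _))// !normrZ.
  apply: (@le_lt_trans _ _ (`|h| * (`|v| + `|c| * `|w|))).
    by rewrite mulrDr lerD2l mulrA ler_wpM2r// -normrM.
  apply: (@le_lt_trans _ _ (`|h| * (`|v| + `|c| * `|w| + 1))).
    by rewrite ler_wpM2l// lerDl.
  by rewrite -ltr_pdivlMr.
have [|s sh ->] := @increment_along R V f w (h *: v + x) (h * c).
  by move=> s sh; have [] := rP _ (hb _ sh).
have [_ sP] := rP _ (hb _ sh).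
rewrite [h^-1 *: _]mulrA mulrA mulVf// mul1r -mulrBr normrM.
apply: (@le_trans _ _ (`|c| * (e / (`|c| + 1)))); first by rewrite ler_wpM2l.
by rewrite mulrCA ler_piMr// ?(ltW e0)// ler_pdivrMr// mul1r lerDl.
Unshelve. all: by end_near. Qed.

Lemma is_derive_C1 (R : realType) (n : nat) (Omega : set 'rV[R]_n.+1)
    (f : 'rV[R]_n.+1 -> R) (x v : 'rV[R]_n.+1) :
  open Omega -> Omega x -> Ck 1 Omega f ->
  is_derive x v f (\sum_i v 0 i * partial i f x).
Proof.
move=> oO Ox [_ Cf].
have nO : \forall y \near x, Omega y by apply: open_nbhs_nbhs; split.
rewrite {1}(row_sum_delta v).
elim: (index_enum _) => [|i s IH]; first by rewrite !big_nil; exact: is_derive0.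
have [dfi [cfi _]] := Cf i.
rewrite !big_cons addrC [X in is_derive _ _ _ X]addrC.
apply: is_derive_direction_add => //; last exact: cfi.
by apply: filterS nO => y /dfi.
Qed.

(** If [d > 0] then [g'] is positive just to the right of 0, and [g] would
    increase there. *)
Lemma second_derivative_test (R : realType) (g g' : R -> R) (d : R) :
  (\forall h \near 0, is_derive h (1 : R) g (g' h)) ->
  is_derive 0 (1 : R) g' d ->
  (\forall h \near 0, g h <= g 0) -> g' 0 = 0 /\ d <= 0.
Proof.
move=> dg dg' maxg.
have /nbhs_ballP[r /= r0 rP] : \forall h \near 0, is_derive h (1 : R) g (g' h) /\ g h <= g 0.
  by near=> h; split; near: h.
have rin (h : R) : h \in `]-r, r[ -> ball 0 r h.
  by rewrite in_itv/= -ball_normE /ball_ /= sub0r normrN ltr_norml.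
have g'0 : g' 0 = 0.
  have H : is_derive 0 (1 : R) g 0.
    apply: (@derive1_at_max R g (-r) r).
    - by rewrite (le_trans (y := 0))// ?oppr_le0 ltW.
    - by move=> t /rin/rP[[]].
    - by rewrite in_itv/= oppr_lt0 r0.
    - by move=> t /rin/rP[].
  have [_ H2] : is_derive 0 (1 : R) g (g' 0) by apply: (proj1 (rP 0 _)); apply: rin; rewrite in_itv/= oppr_lt0 r0.
  by case: H => _ H; rewrite -H2 H.
split=> //; rewrite leNgt; apply/negP => d0.
have := dg'; case=> ex1 E.
have q : h^-1 *: (g' (h *: 1 + 0) - g' 0) @[h --> 0^'] --> d by rewrite -E; exact: ex1.
have /cvgrPdist_lt /(_ d d0) /= := q.
rewrite /dnbhs /within /= => /nbhs_ballP[s /= s0 sP].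
have pos h : 0 < h -> h < s -> 0 < g' h.
  move=> h0 hs; have /sP : ball (0 : R) s h by rewrite -ball_normE /ball_ /= sub0r normrN gtr0_norm.
  move=> /(_ (lt0r_neq0 h0)); rewrite g'0 subr0 addr0 [h *: 1]mulr1 [_ *: _]/(_ * _).
  rewrite ltr_norml => /andP[_]; rewrite ltrBlDr -ltrBlDl subrr => H.
  by move: H; rewrite pmulr_rgt0// invr_gt0.
pose k := Num.min r s / 2.
have m0 : 0 < Num.min r s by rewrite lt_min r0 s0.
have k0 : 0 < k by rewrite divr_gt0.
have km : k < Num.min r s by rewrite /k; lra.
have [kr ks] : k < r /\ k < s by move: km; rewrite lt_min => /andP[].
have kin t : t \in `[0, k] -> ball 0 r t.
  rewrite in_itv/= => /andP[t0 tk]; apply: rin; rewrite in_itv/=.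
  by rewrite (lt_le_trans _ t0) ?oppr_lt0//= (le_lt_trans tk).
have [||t tk E1] := @MVT R g g' 0 k k0.
- by move=> t tk; apply: (proj1 (rP _ (kin _ _))); apply: subset_itv_oo_cc.
- by apply: derivable_within_continuous => t /kin/rP[[]].
have : 0 < g' t * (k - 0).
  rewrite subr0 mulr_gt0//; move: tk; rewrite in_itv/= => /andP[t0 tk].
  by apply: pos => //; exact: lt_trans ks.
rewrite -E1 subr_gt0 ltNge.
by rewrite (proj2 (rP _ (kin k _)))// in_itv/= lexx ltW.
Unshelve. all: by end_near. Qed.

(** Restricting to lines through [x] and applying the one-variable test shows
    that the gradient vanishes and that the Hessian is a nonpositive form. The
    derivatives of the coefficients then only multiply the zero gradient. *)
Lemma elliptic_op_ge0_at_max (R : realType) (n : nat) (Omega : set 'rV[R]_n.+1)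
    (a : 'rV[R]_n.+1 -> R -> 'M[R]_n.+1) (b : 'rV[R]_n.+1 -> R -> 'rV[R]_n.+1)
    (u : 'rV[R]_n.+1 -> R -> R) (x : 'rV[R]_n.+1) (t : R) :
  open Omega -> Omega x -> sym_posdef (a x t) ->
  (forall i j, Ck 1 Omega (fun y => a y t i j)) ->
  Ck 2 Omega (fun y => u y t) ->
  (forall y, Omega y -> u y t <= u x t) ->
  0 <= elliptic_op a b u x t.
Proof.
move=> oO Ox [aT apos] Ca Cu umax.
set f := fun y => u y t in Cu.
have [Cf0 Cf] := Cu.
have Cf1 : Ck 1 Omega f.
  by split=> // i; have [? [? _]] := Cf i; split=> //; split.
have nO (v : 'rV[R]_n.+1) : \forall h \near (0 : R), Omega (x + h *: v).
  have : (x + h *: v) @[h --> (0 : R)] --> x.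
    rewrite -[X in _ --> X]addr0 -(scale0r v).
    by apply: cvgD; [exact: cvg_cst|apply: cvgZr_tmp; exact: cvg_id].
  by apply; apply: open_nbhs_nbhs; split.
pose H i j := partial i (partial j f) x.
have along (v : 'rV[R]_n.+1) :
    \sum_i v 0 i * partial i f x = 0 /\
    \sum_i v 0 i * (\sum_j v 0 j * H j i) <= 0.
  have := @second_derivative_test R (fun h => f (x + h *: v))
    (fun h => \sum_i v 0 i * partial i f (x + h *: v))
    (\sum_i v 0 i * (\sum_j v 0 j * H j i)).
  rewrite !scale0r !addr0; apply.
  - apply: filterS (nO v) => h Oh.
    apply: is_derive_along; exact (is_derive_C1 v oO Oh Cf1).
  - have -> : (fun h => \sum_i v 0 i * partial i f (x + h *: v)) =
       \sum_i (v 0 i \*: (fun h : R => partial i f (x + h *: v))).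
      by apply/funext => h; rewrite fct_sumE.
    apply: is_derive_sum => i; apply: is_deriveZ.
    apply: is_derive_along; rewrite scale0r addr0; apply: is_derive_C1 oO Ox _.
    by have [_ ] := Cf i.
  - by apply: filterS (nO v) => h Oh; exact: umax.
have grad i : partial i f x = 0.
  have [<- _] := along (delta_mx 0 i).
  rewrite (bigD1 i)//= mxE !eqxx mul1r big1 ?addr0// => j ji.
  by rewrite mxE eqxx (negbTE ji) mul0r.
rewrite /elliptic_op [X in _ + X]big1 ?addr0; last first.
  by move=> i _; rewrite grad mulr0.
rewrite oppr_ge0.
have expand i j : partial i (fun y => a y t i j * partial j f y) x = a x t i j * H i j.
  rewrite /partial (_ : (fun y => _) = (fun y => a y t i j) * partial j f)//.
  rewrite deriveM.
  - by rewrite grad scale0r addr0.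
  - by have [_ /(_ i)[/(_ x Ox)]] := Ca i j.
  - by have [_ [_ /(_ i)[/(_ x Ox)]]] := Cf j.
under eq_bigr => i _ do under eq_bigr => j _ do rewrite expand.
apply: posdef_frobenius_le0.
- by move=> i j; rewrite -[in LHS]aT mxE.
- move=> v [i vi].
  pose xi := \row_j v j.
  have /apos : xi != 0.
    by apply/eqP => /rowP/(_ i); rewrite !mxE; apply/eqP.
  rewrite mxE; congr (_ < _); rewrite exchange_big /=; apply: eq_bigr => k _.
  by rewrite !mxE mulr_suml; apply: eq_bigr => j _; rewrite !mxE.
- move=> v; have [_] := along (\row_j v j).
  rewrite exchange_big /=; congr (_ <= _); apply: eq_bigr => i _.
  rewrite mulr_sumr; apply: eq_bigr => j _; rewrite !mxE; ring.
Qed.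

(** * A smooth step function *)

(** Recursion on the function that is differentiated makes stability under the
    algebraic operations a plain induction. *)
Fixpoint derivable_n (R : realType) (k : nat) (f : R -> R) : Prop :=
  (forall s, derivable f s 1) /\
  (if k is k'.+1 then derivable_n k' (derive1 f) else True).

Lemma derivable_n_derive1n (R : realType) (f : R -> R) :
  (forall k, derivable_n k f) -> forall k s, derivable (derive1n k f) s 1.
Proof.
move=> + k; elim: k f => [|k IH] f fn s; first by have [] := fn 0%N.
rewrite derive1Sn; apply: IH => m; exact: (fn m.+1).2.
Qed.

Lemma derivable_nS (R : realType) k (f : R -> R) : derivable_n k.+1 f -> derivable_n k f.
Proof.
elim: k f => [|k IH] f [df f']; first exact: conj df I.
exact: conj df (IH _ f').
Qed.

Lemma derivable_n_eq (R : realType) k (f f' : R -> R) :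
  (forall s : R, is_derive s (1 : R) f (f' s)) -> derivable_n k f' -> derivable_n k.+1 f.
Proof.
move=> df f'n; split=> [s|]; first by have [] := df s.
suff -> : (derive1 f) = f' by [].
by apply/funext => s; rewrite derive1E; case: (df s).
Qed.

Lemma is_derive1 (R : realType) (f : R -> R) (s : R) :
  derivable f s 1 -> is_derive s (1 : R) f ((derive1 f) s).
Proof. by move=> df; rewrite derive1E; exact: derivableP. Qed.

Lemma derivable_n_cst (R : realType) k (c : R) : derivable_n k (fun _ : R => c).
Proof.
elim: k c => [|k IH] c; first by split=> // s; exact: derivable_cst.
by apply: (@derivable_n_eq _ _ _ (fun=> 0)) => // s; exact: is_derive_cst.
Qed.

Lemma derivable_nD (R : realType) k (f g : R -> R) :
  derivable_n k f -> derivable_n k g -> derivable_n k (fun s => f s + g s).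
Proof.
elim: k f g => [|k IH] f g [df fn] [dg gn].
  by split=> [s|]; [exact: derivableD|exact: I].
apply: (@derivable_n_eq _ _ _ (fun s => (derive1 f) s + (derive1 g) s)); last exact: IH.
by move=> s; apply: is_deriveD; exact: is_derive1.
Qed.

Lemma derivable_nM (R : realType) k (f g : R -> R) :
  derivable_n k f -> derivable_n k g -> derivable_n k (fun s => f s * g s).
Proof.
elim: k f g => [|k IH] f g nf ng.
  by split=> [s|]; [apply: derivableM; [exact: nf.1|exact: ng.1]|exact: I].
apply: (@derivable_n_eq _ _ _ (fun s => f s * (derive1 g) s + g s * (derive1 f) s)).
  move=> s; apply: is_deriveM; apply: is_derive1; [exact: nf.1|exact: ng.1].
apply: derivable_nD; apply: IH; [exact: derivable_nS|exact: ng.2|exact: derivable_nS|exact: nf.2].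
Qed.

Lemma derivable_nN (R : realType) k (f : R -> R) :
  derivable_n k f -> derivable_n k (fun s => - f s).
Proof.
move=> fn; rewrite (_ : (fun s => - f s) = (fun s => (- 1) * f s)).
  by apply: derivable_nM => //; exact: derivable_n_cst.
by apply/funext => s; rewrite mulN1r.
Qed.

Lemma is_derive_inv (R : realType) (f : R -> R) (s f' : R) : f s != 0 ->
  is_derive s (1 : R) f f' -> is_derive s (1 : R) (fun s => (f s)^-1) (- (f s) ^- 2 * f').
Proof.
move=> f0 [df <-]; apply: DeriveDef; first exact: derivableV.
by rewrite deriveV.
Qed.

Lemma derivable_nV (R : realType) k (f : R -> R) : (forall s, f s != 0) ->
  derivable_n k f -> derivable_n k (fun s => (f s)^-1).
Proof.
move=> f0; elim: k => [|k IH] nf.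
  by split=> [s|]; [apply: derivableV; [exact: f0|exact: nf.1]|exact: I].
have fk := IH (derivable_nS nf).
apply: (@derivable_n_eq _ _ _ (fun s => - ((f s)^-1 * (f s)^-1 * (derive1 f) s))).
  move=> s; have := is_derive_inv (f0 s) (is_derive1 (nf.1 s)).
  by rewrite expr2 invfM mulNr.
apply: derivable_nN; apply: derivable_nM; last exact: nf.2.
exact: derivable_nM.
Qed.

Lemma is_derive_affine (R : realType) (f : R -> R) (c d s f' : R) :
  is_derive (c * s + d) (1 : R) f f' ->
  is_derive s (1 : R) (fun s => f (c * s + d)) (c * f').
Proof.
move=> df.
have H : is_derive s (1 : R) (fun s : R => c * s + d) c.
  have [dH H] := is_deriveD (is_deriveZ c (is_derive_id s (1 : R))) (is_derive_cst d s (1 : R)).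
  apply: DeriveDef; first exact: dH.
  by rewrite /= H [c *: _]mulr1 addr0.
by have := @is_derive1_comp _ f (fun s => c * s + d) s _ _ df H; rewrite mulrC.
Qed.

Lemma derivable_n_affine (R : realType) k (f : R -> R) (c d : R) :
  derivable_n k f -> derivable_n k (fun s => f (c * s + d)).
Proof.
elim: k f => [|k IH] f nf.
  by split=> // s; have [] := is_derive_affine (is_derive1 (nf.1 (c * s + d))).
apply: (@derivable_n_eq _ _ _ (fun s => c * (derive1 f) (c * s + d))).
  by move=> s; apply: is_derive_affine; apply: is_derive1; exact: nf.1.
apply: derivable_nM; first exact: derivable_n_cst.
exact: IH nf.2.
Qed.

(** The functions [x^-k * exp (- 1 / x)] extended by zero to [x <= 0], all of
    them flat at 0. *)
Definition flat_exp (R : realType) (k : nat) (x : R) : R :=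
  if 0 < x then x^-1 ^+ k * expR (- x^-1) else 0.

Lemma flat_exp_ge0 (R : realType) k (x : R) : 0 <= flat_exp k x.
Proof.
rewrite /flat_exp; case: ltP => // x0.
by rewrite mulr_ge0 ?expR_ge0// exprn_ge0// invr_ge0 ltW.
Qed.

(** From [y ^ (k + 2) <= (k + 2)! * exp y] with [y = 1 / x]. The square on the
    right makes [flat_exp k] differentiable at 0. *)
Lemma flat_exp_le (R : realType) k (x : R) : flat_exp k x <= x ^+ 2 * (k.+2)`!%:R.
Proof.
rewrite /flat_exp; case: ltP => [x0|_]; last by rewrite mulr_ge0// sqr_ge0.
have y0 : 0 < x^-1 by rewrite invr_gt0.
rewrite -[X in _ <= X ^+ 2 * _]invrK; move: (x^-1) y0 => y y0.
rewrite expRN ler_pdivrMr ?expR_gt0// exprVn -mulrA ler_pdivlMl ?exprn_gt0//.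
rewrite -exprD add2n -ler_pdivrMl ?ltr0n ?fact_gt0// mulrC.
by rewrite (le_trans _ (expR_ge1Dxn k.+1 (ltW y0)))// lerDr.
Qed.

(** The family of all [flat_exp k] is closed under differentiation up to linear
    combinations, which makes each member infinitely differentiable. *)
Lemma is_derive_flat_exp (R : realType) k (x : R) :
  is_derive x (1 : R) (flat_exp k) (flat_exp k.+2 x - k%:R * flat_exp k.+1 x).
Proof.
have [x0|x0|->] := ltgtP x 0.
- rewrite /flat_exp !ltNge (ltW x0)/= mulr0 subr0.
  apply: (@near_eq_is_derive _ _ _ (cst 0)).
  near=> y; rewrite ltNge ifF//; apply/negbF; apply/ltW; near: y; exact: lt_nbhsl.
- have pos j (z : R) : 0 < z -> flat_exp j z = z^-1 ^+ j * expR (- z^-1) by rewrite /flat_exp => ->.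
  rewrite !pos//.
  apply: (@near_eq_is_derive R R R (fun x => x^-1 ^+ k * expR (- x^-1))).
    by near=> y; rewrite pos//; near: y; exact: lt_nbhsr.
  have dV : is_derive x (1 : R) (fun y : R => y^-1) (- x ^- 2).
    have := @is_derive_inv _ (@id R) x 1 (lt0r_neq0 x0) (is_derive_id _ _).
    by rewrite mulr1.
  have dN : is_derive x (1 : R) (fun y : R => - y^-1) (x ^- 2).
    by have := is_deriveN dV; rewrite opprK.
  have dE := @is_derive1_comp R expR (fun y : R => - y^-1) x _ _ (is_derive_expR _) dN.
  have dX := is_deriveX k dV.
  have := is_deriveM dX dE.
  have -> : (fun y : R => y^-1) ^+ k * (expR \o (fun y : R => - y^-1)) =
    (fun y : R => y^-1 ^+ k * expR (- y^-1)) by apply/funext => y /=; rewrite exprfctE.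
  have E : forall y : R, ((fun y : R => y^-1) ^+ k) y = y^-1 ^+ k by move=> y; rewrite exprfctE.
  rewrite E; congr is_derive.
  rewrite /GRing.scale/= -exprVn; case: k {dX E} => [|k].
    by rewrite !mul0r mulr0 subr0 addr0 expr0 mul1r mulrC.
  by rewrite /= !exprS; ring.
- rewrite /flat_exp ltxx mulr0 subr0.
  have q : h^-1 *: (flat_exp k (h *: 1 + 0) - flat_exp k 0) @[h --> (0 : R)^'] --> (0 : R).
    have C0 : 0 < (k.+2)`!%:R :> R by rewrite ltr0n fact_gt0.
    apply/cvgrPdist_le => e e0; near=> h.
    have h0 : h != 0 by near: h; exact: nbhs_dnbhs_neq.
    rewrite sub0r normrN [h *: 1]mulr1 addr0 {2}/flat_exp ltxx subr0 normrM normfV.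
    rewrite ler_pdivrMl ?normr_gt0// (ger0_norm (flat_exp_ge0 _ _)).
    rewrite (le_trans (flat_exp_le _ _))//.
    rewrite -(real_normK (num_real h)) expr2 -mulrA ler_wpM2l// -ler_pdivlMr//.
    by near: h; apply: dnbhs0_le; exact: divr_gt0.
  by apply: DeriveDef; [apply: cvgP q | apply: cvg_lim q].
Unshelve. all: by end_near. Qed.

Lemma derivable_n_flat_exp (R : realType) m k : derivable_n m (@flat_exp R k).
Proof.
elim: m k => [|m IH] k.
  by split=> [s|]; [case: (is_derive_flat_exp k s)|exact: I].
apply: (@derivable_n_eq _ _ _ (fun x => flat_exp k.+2 x - k%:R * flat_exp k.+1 x)).
  exact: is_derive_flat_exp.
apply: derivable_nD; first exact: IH.
by apply: derivable_nN; apply: derivable_nM; [exact: derivable_n_cst|exact: IH].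
Qed.

(** The denominator never vanishes, so this is smooth; it is constant on both
    sides of [0, 1]. *)
Definition smooth_step (R : realType) (x : R) : R :=
  flat_exp 0 x / (flat_exp 0 x + flat_exp 0 (1 - x)).

Lemma smooth_step_den (R : realType) (x : R) : 0 < flat_exp 0 x + flat_exp 0 (1 - x).
Proof.
have H (y : R) : 0 < y -> 0 < flat_exp 0 y by rewrite /flat_exp => ->; rewrite expr0 mul1r expR_gt0.
have [x0|x0] := ltP 0 x; first by rewrite ltr_pwDl ?H ?flat_exp_ge0.
by rewrite ltr_wpDl ?flat_exp_ge0// H// subr_gt0 (le_lt_trans x0).
Qed.

Lemma smooth_step0 (R : realType) (x : R) : x <= 0 -> smooth_step x = 0.
Proof. by move=> x0; rewrite /smooth_step {1}/flat_exp ltNge x0 mul0r. Qed.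

Lemma smooth_step1 (R : realType) (x : R) : 1 <= x -> smooth_step x = 1.
Proof.
move=> x1; have := smooth_step_den x.
have -> : flat_exp 0 (1 - x) = 0 by rewrite /flat_exp subr_gt0 ltNge x1.
rewrite addr0 => H; rewrite /smooth_step.
have -> : flat_exp 0 (1 - x) = 0 by rewrite /flat_exp subr_gt0 ltNge x1.
by rewrite addr0 divff// gt_eqF.
Qed.

Lemma smooth_step_itv (R : realType) (x : R) : 0 <= smooth_step x <= 1.
Proof.
have d0 := smooth_step_den x; rewrite /smooth_step divr_ge0 ?flat_exp_ge0 ?(ltW d0)//=.
by rewrite ler_pdivrMr// mul1r lerDl flat_exp_ge0.
Qed.

Lemma derivable_n_smooth_step (R : realType) k : derivable_n k (@smooth_step R).
Proof.
apply: derivable_nM; first exact: derivable_n_flat_exp.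
apply: derivable_nV; first by move=> s; rewrite gt_eqF// smooth_step_den.
apply: derivable_nD; first exact: derivable_n_flat_exp.
rewrite (_ : (fun s : R => _) = (fun s => flat_exp 0 ((-1) * s + 1))).
  by apply: derivable_n_affine; exact: derivable_n_flat_exp.
by apply/funext => s; rewrite mulN1r addrC.
Qed.

Lemma derive1_smooth_step0 (R : realType) (x : R) : (x < 0) || (1 < x) ->
  derive1 (@smooth_step R) x = 0.
Proof.
move=> /orP[x0|x1]; rewrite derive1E.
  rewrite (@near_eq_derive R R R _ (cst 0)) ?derive_cst//.
  by near=> y; rewrite smooth_step0//; apply/ltW; near: y; exact: lt_nbhsl.
rewrite (@near_eq_derive R R R _ (cst 1)) ?derive_cst//.
by near=> y; rewrite smooth_step1//; apply/ltW; near: y; exact: lt_nbhsr.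
Unshelve. all: by end_near. Qed.

Lemma derive1_smooth_step_bounded (R : realType) :
  exists2 C : R, 0 < C & forall x, `|derive1 (@smooth_step R) x| <= C.
Proof.
have c : {within `[0, 1], continuous (fun x => `|derive1 (@smooth_step R) x|)}.
  apply: continuous_subspaceT => x.
  apply: cvg_norm; apply: differentiable_continuous; apply/derivable1_diffP.
  exact: (derivable_n_smooth_step R 1).2.1.
have [d d01 dmax] := EVT_max ler01 c.
exists (`|derive1 (@smooth_step R) d| + 1); first by rewrite ltr_wpDl.
move=> x; apply: (@le_trans _ _ `|derive1 (@smooth_step R) d|); last by rewrite lerDl.
have [x01|] := boolP (x \in `[0, 1]); first exact: dmax.
rewrite in_itv/= negb_and -!ltNge => H.
by rewrite derive1_smooth_step0// normr0.
Qed.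

(** The smooth step carried over to [c, c + h]. *)
Definition step_from (R : realType) (c h s : R) : R :=
  smooth_step (h^-1 * s + - (c / h)).

Section step_from.
Variables (R : realType) (c h : R).
Hypothesis h0 : 0 < h.
Let argE s : h^-1 * s + - (c / h) = (s - c) / h.
Proof. by rewrite mulrBl mulrC. Qed.

Lemma step_from0 s : s <= c -> step_from c h s = 0.
Proof.
by move=> sc; rewrite /step_from argE smooth_step0// ler_pdivrMr// mul0r subr_le0.
Qed.

Lemma step_from1 s : c + h <= s -> step_from c h s = 1.
Proof.
move=> sc; rewrite /step_from argE smooth_step1// ler_pdivlMr// mul1r.
by rewrite lerBrDl.
Qed.

Lemma step_from_itv s : 0 <= step_from c h s <= 1.
Proof. exact: smooth_step_itv. Qed.

Lemma derivable_n_step_from k : derivable_n k (step_from c h).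
Proof. by apply: derivable_n_affine; exact: derivable_n_smooth_step. Qed.

Lemma derive1_step_from s :
  derive1 (step_from c h) s = h^-1 * derive1 (@smooth_step R) ((s - c) / h).
Proof.
have [_ E] : is_derive s (1 : R) (step_from c h)
    (h^-1 * derive1 (@smooth_step R) (h^-1 * s + - (c / h))).
  apply: (@is_derive_affine R (@smooth_step R)).
  exact (is_derive1 ((derivable_n_smooth_step R 0).1 _)).
rewrite -argE derive1E; exact E.
Qed.

Lemma derive1_step_from0 s : (s < c) || (c + h < s) -> derive1 (step_from c h) s = 0.
Proof.
move=> H; rewrite derive1_step_from derive1_smooth_step0 ?mulr0//.
by rewrite ltr_pdivrMr// ltr_pdivlMr// mul0r mul1r subr_lt0 ltrBrDl.
Qed.

Lemma continuous_derive1_step_from : continuous (derive1 (step_from c h)).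
Proof.
move=> s; apply: differentiable_continuous; apply/derivable1_diffP.
exact: (derivable_n_step_from 1).2.1.
Qed.

Lemma continuous_step_from : continuous (step_from c h).
Proof.
move=> s; apply: differentiable_continuous; apply/derivable1_diffP.
exact: (derivable_n_step_from 0).1.
Qed.

Lemma Rintegral_derive1_step_from :
  \int[lebesgue_measure]_(s in `[c, c + h]) derive1 (step_from c h) s = 1.
Proof.
have ch : c < c + h by rewrite ltrDl.
rewrite /Rintegral (@continuous_FTC2 _ _ (step_from c h))//.
- by rewrite step_from1// step_from0//= subr0.
- by apply: continuous_subspaceT; exact: continuous_derive1_step_from.
- split=> [s _||].
  + exact: (derivable_n_step_from 0).1.
  + by apply: cvg_at_right_filter; exact: continuous_step_from.
  + by apply: cvg_at_left_filter; exact: continuous_step_from.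
Qed.
End step_from.

(** * The fundamental theorem of calculus for weak derivatives *)

(** Setting [g] to zero outside the interval and where it exceeds its essential
    bound changes it on a null set of the interval only. The result is bounded
    everywhere, so that no later argument needs to deal with null sets. *)
Lemma Loo_bounded_repr (R : realType) (a b : R) (g : R -> R) : Loo a b g ->
  exists (g' : R -> R) (M : R),
    [/\ measurable_fun setT g', forall s, `|g' s| <= M &
    forall (D : set R) (k : R -> R), measurable D -> D `<=` `]a, b[ -> measurable_fun D k ->
      \int[lebesgue_measure]_(s in D) (g s * k s) = \int[lebesgue_measure]_(s in D) (g' s * k s)].
Proof.
pose G : R -> R := g \_ `]a, b[.
rewrite /Loo -[g \_ _]/G => /[dup] /sub_Lfun_mfun mG /sub_Lfun_finLfun.
have {}mG : measurable_fun setT G by move: mG; rewrite inE.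
have muT : (0 < (lebesgue_measure : set R -> \bar R) setT)%E.
  by rewrite -set_itvNyy lebesgue_measure_itv/= addye// lt0y.
rewrite inE /= /finite_norm Lnorm.unlock ifT; last exact: muT.
move=> Goo.
have [M aeM] : exists M : R, \forall x \ae (lebesgue_measure : set R -> \bar R), `|G x| <= M.
  have [M GM] : exists M : R, (ess_sup (lebesgue_measure : set R -> \bar R) (abse \o (EFin \o G)) <= M%:E)%E.
    move: Goo; case: ess_sup => [r|//|] _; [by exists r|by exists 0; rewrite leNye].
  exists M; move/ess_supP: GM; apply: filterS => x /=.
  by rewrite lee_fin.
pose A := [set s | `|G s| <= M].
have mA : measurable A.
  have mN : measurable_fun setT (fun s => `|G s|) by exact: measurableT_comp.
  have := mN measurableT _ (measurable_itv `]-oo, M]); rewrite setTI.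
  by congr measurable; apply/seteqP; split => s /=; rewrite in_itv.
exists (fun s => G s * \1_A s), `|M|; split.
- by apply: measurable_funM => //; exact: measurable_indic.
- move=> s; rewrite indicE; case: (boolP (s \in A)) => [|_].
    by rewrite inE => As; rewrite mulr1 (le_trans As)// ler_norm.
  by rewrite mulr0 normr0.
- move=> D k mD Dab mk; rewrite /Rintegral; congr fine.
  apply: ae_eq_integral => //.
  + apply/measurable_EFinP; apply: measurable_funM => //.
    apply: (eq_measurable_fun G).
      by move=> s /set_mem /Dab ab; rewrite /G patchE mem_set.
    exact: measurable_funS mG.
  + apply/measurable_EFinP; apply: measurable_funM => //.
    apply: measurable_funM; first exact: measurable_funS mG.
    by apply: measurable_funTS; exact: measurable_indic.
  + have FF := ae_filter_ringOfSetsType (lebesgue_measure : set R -> \bar R). apply: (@filterS _ _ FF _ _ _ aeM) => s sM Ds.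
    rewrite indicE mem_set// mulr1; congr (_ * _)%:E.
    by rewrite /G patchE mem_set//; exact: Dab.
Qed.

Lemma Rintegral_sub_support (R : realType) (D E : set R) (f : R -> R) :
  E `<=` D -> (forall s, D s -> ~ E s -> f s = 0) ->
  \int[lebesgue_measure]_(s in D) f s = \int[lebesgue_measure]_(s in E) f s.
Proof.
move=> ED f0; rewrite Rintegral_mkcond [RHS]Rintegral_mkcond; congr Rintegral.
apply/funext => s; rewrite !patchE.
case: ifPn => [/set_mem Ds|nD]; case: ifPn => [/set_mem Es|nE] //.
- by apply: f0 => // Es; move: nE; rewrite mem_set.
- by move: nD; rewrite mem_set//; exact: ED.
Qed.

Lemma integrable_continuousM (R : realType) (a b : R) (v f : R -> R) (D : set (measurableTypeR R)) :
  {within `[a, b], continuous v} -> {within `[a, b], continuous f} ->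
  measurable D -> D `<=` `[a, b] ->
  lebesgue_measure.-integrable D (EFin \o (fun s => v s * f s)).
Proof.
move=> cv cf mD Dab. refine (integrableS _ mD Dab _); first exact: measurable_itv.
apply: continuous_compact_integrable; first exact: segment_compact.
by move=> s; apply: cvgM; [exact: cv|exact: cf].
Qed.

Lemma Rintegral_cst_itv (R : realType) (p q r : R) : p <= q ->
  \int[lebesgue_measure]_(s in `[p, q]) r = r * (q - p).
Proof.
move=> pq; rewrite Rintegral_cst//.
congr (_ * _).
rewrite -[X in fine X]/(lebesgue_measure `[p, q]%classic).
rewrite lebesgue_measure_itv/= lte_fin.
move: pq; rewrite le_eqVlt => /predU1P[->|pq]; first by rewrite ltxx subrr.
by rewrite pq.
Qed.

(** The derivative of the step has total mass 1, lives on [c, c + h] and is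
    bounded by [C / h], so integrating [v] against it evaluates [v] up to [C]
    times its oscillation there. *)
Lemma step_from_concentrates (R : realType) (C a b c h k e : R) (v : R -> R) :
  (forall x, `|derive1 (@smooth_step R) x| <= C) ->
  0 < h -> a < c -> c + h < b -> {within `[a, b], continuous v} ->
  (forall s, s \in `[c, c + h] -> `|v s - k| <= e) ->
  `|\int[lebesgue_measure]_(s in `]a, b[) (v s * derive1 (step_from c h) s) - k| <= C * e.
Proof.
move=> dC h0 ac cb cv vk.
have sub : `[c, c + h]%classic `<=` `[a, b].
  by apply: subset_itvScc; apply/ltW.
have ct (A : set R) (f : R -> R) : continuous f -> {within A, continuous f} by exact: continuous_subspaceT.
have cd := @continuous_derive1_step_from R c h.
rewrite (@Rintegral_sub_support _ _ `[c, c + h]); first last.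
- move=> s _ /= /negP; rewrite in_itv/= negb_and -!ltNge => H.
  by rewrite derive1_step_from0// mulr0.
- by apply: subset_itv; rewrite bnd_simp.
have -> : k = \int[lebesgue_measure]_(s in `[c, c + h]) (k * derive1 (step_from c h) s).
  rewrite RintegralZl//; first by rewrite Rintegral_derive1_step_from// mulr1.
  apply: continuous_compact_integrable; first exact: segment_compact.
  exact: ct.
rewrite -RintegralB//; first last.
- apply: (@integrable_continuousM _ a b) => //; [exact: ct (@cst_continuous _ _ k)|exact: ct].
- by apply: (@integrable_continuousM _ a b) => //; exact: ct.
under eq_Rintegral do rewrite -mulrBl.
have ck : {within `[a, b], continuous (fun s => v s - k)}.
  by move=> s; apply: cvgB; [exact: cv|exact: cvg_cst].
rewrite (le_trans (le_normr_Rintegral _ _))//.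
  by apply: (@integrable_continuousM _ a b) => //; exact: ct.
have -> : C * e = \int[lebesgue_measure]_(s in `[c, c + h]) (h^-1 * C * e).
  rewrite Rintegral_cst_itv ?lerDl ?(ltW h0)// [c + h]addrC addrK.
  by rewrite [_ * h]mulrC !mulrA divff ?gt_eqF// mul1r.
apply: le_Rintegral => //.
- apply: integrable_norm.
  by apply: (@integrable_continuousM _ a b) => //; exact: ct.
- apply: continuous_compact_integrable; first exact: segment_compact.
  apply: ct; exact: cst_continuous.
- move=> s sc; rewrite normrM derive1_step_from// normrM mulrC.
  rewrite ger0_norm ?invr_ge0 ?(ltW h0)//.
  by rewrite ler_pM ?mulr_ge0 ?invr_ge0 ?(ltW h0)// ?ler_pM2l ?invr_gt0//; apply: vk.
Qed.

Lemma step_diff_test_function (R : realType) (a b c d h : R) :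
  0 < h -> a < c -> c + h <= d -> d + h < b ->
  test_function a b (fun s => step_from c h s - step_from d h s).
Proof.
move=> h0 ac cd db; split.
  apply: derivable_n_derive1n => k; apply: derivable_nD.
    exact: derivable_n_step_from.
  by apply: derivable_nN; exact: derivable_n_step_from.
exists `[c, d + h]%classic; split.
- exact: segment_compact.
- by apply: subset_itv; rewrite bnd_simp.
- move=> s /= /negP; rewrite in_itv/= negb_and -!ltNge => /orP[sc|sd].
    have cd' : c <= d by rewrite (le_trans _ cd)// lerDl ltW.
    by rewrite !step_from0 ?subrr ?(ltW sc)// (le_trans (ltW sc)).
  rewrite !step_from1 ?subrr// ?(ltW sd)//.
  by rewrite (le_trans cd)// (le_trans _ (ltW sd))// lerDl ltW.
Qed.

Lemma bounded_integrable_itv (R : realType) (a b M : R) (f : R -> R)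
    (D : set (measurableTypeR R)) :
  measurable D -> D `<=` `[a, b] -> measurable_fun D f -> (forall s, D s -> `|f s| <= M) ->
  lebesgue_measure.-integrable D (EFin \o f).
Proof.
move=> mD Dab mf fM; apply: measurable_bounded_integrable => //.
  have mab : measurable (`[a, b]%classic : set (measurableTypeR R)) by exact: measurable_itv.
  apply: (@le_lt_trans _ _ (lebesgue_measure `[a, b]%classic)).
    by apply: le_measure => //; rewrite inE.
  by rewrite lebesgue_measure_itv/= -EFinB; case: ifP => _; rewrite ltry.
exists M; split; first exact: num_real.
by move=> x Mx s Ds; apply: le_trans (fM _ Ds) _; exact: ltW.
Qed.

Lemma Rintegral_itv3 (R : realType) (a b p q : R) (f : R -> R) :
  a <= p -> p <= q -> q < b ->
  lebesgue_measure.-integrable `]a, b[ (EFin \o f) ->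
  \int[lebesgue_measure]_(s in `]a, b[) f s =
    \int[lebesgue_measure]_(s in `]a, p]) f s + \int[lebesgue_measure]_(s in `]p, q]) f s
    + \int[lebesgue_measure]_(s in `]q, b[) f s.
Proof.
move=> ap pq qb fi.
have pb : p < b := le_lt_trans pq qb.
have E1 := @Rintegral_itvB R f (BRight a) (BLeft b) p fi ap pb.
have fi2 : lebesgue_measure.-integrable `]p, b[ (EFin \o f).
  refine (integrableS _ _ _ fi); try exact: measurable_itv.
  by apply: subset_itvr; rewrite bnd_simp.
have E2 := @Rintegral_itvB R f (BRight p) (BLeft b) q fi2 pq qb.
by move: E1 E2; do 5! move: (Rintegral _ _ _) => ?; lra.
Qed.

Lemma le_norm_Rintegral_itv (R : realType) (p q M : R) (f : R -> R) (x y : bool) :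
  p <= q -> 0 <= M -> measurable_fun [set` Interval (BSide x p) (BSide y q)] f ->
  (forall s, s \in Interval (BSide x p) (BSide y q) -> `|f s| <= M) ->
  `|\int[lebesgue_measure]_(s in [set` Interval (BSide x p) (BSide y q)]) f s| <= M * (q - p).
Proof.
move=> pq M0 mf fM.
have sub : [set` Interval (BSide x p) (BSide y q)] `<=` `[p, q].
  by apply: subset_itvScc; rewrite bnd_simp; case: x {mf fM}; case: y; rewrite !bnd_simp.
have fi (f' : R -> R) : measurable_fun [set` Interval (BSide x p) (BSide y q)] f' ->
    (forall s, s \in Interval (BSide x p) (BSide y q) -> `|f' s| <= M) ->
    lebesgue_measure.-integrable [set` Interval (BSide x p) (BSide y q)] (EFin \o f').
  by move=> mf' f'M; apply: (@bounded_integrable_itv _ p q M).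
rewrite (le_trans (le_normr_Rintegral _ _))//; first exact: fi.
apply: (@le_trans _ _ (\int[lebesgue_measure]_(s in [set` Interval (BSide x p) (BSide y q)]) M)).
  apply: le_Rintegral => //; first by apply: integrable_norm; exact: fi.
  by apply: fi => // s _; rewrite ger0_norm.
rewrite Rintegral_cst// ler_wpM2l//.
rewrite -[X in fine X]/(lebesgue_measure [set` Interval (BSide x p) (BSide y q)]).
rewrite lebesgue_measure_itv/= lte_fin.
by case: ifP => _ //=; rewrite subr_ge0.
Qed.

Lemma approx_combine (R : realType) (A B G G' x y p k : R) :
  `|A - x| <= p -> `|B - y| <= p -> A - B = - G' -> `|G - G'| <= k ->
  `|G - (y - x)| <= p *+ 2 + k.
Proof.
rewrite !ler_norml => /andP[? ?] /andP[? ?] ? /andP[? ?].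
by apply/andP; split; lra.
Qed.

Section weak_FTC.
Variables (R : realType) (a b : R) (v g : R -> R) (M C : R).
Hypothesis dC : forall x, `|derive1 (@smooth_step R) x| <= C.
Hypothesis cv : {within `[a, b], continuous v}.
Hypothesis mg : measurable_fun setT g.
Hypothesis gM : forall s, `|g s| <= M.
Hypothesis vg : forall phi : R -> R, test_function a b phi ->
    \int[lebesgue_measure]_(s in `]a, b[) (v s * derive1 phi s) =
    - \int[lebesgue_measure]_(s in `]a, b[) (g s * phi s).

(** The test function is a plateau: it rises on [r + h, r + 2h] and falls on
    [b - 2h, b - h]. Its derivative picks out [v r - v b], while the plateau
    itself differs from the indicator of the interval on a set of length [4h]. *)
Lemma weak_FTC_estimate (r h e : R) : a <= r -> 0 < h -> r + h *+ 4 < b ->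
  (forall s, s \in `[r + h, r + h *+ 2] -> `|v s - v r| <= e) ->
  (forall s, s \in `[b - h *+ 2, b - h] -> `|v s - v b| <= e) ->
  `|\int[lebesgue_measure]_(s in `]r, b[) g s - (v b - v r)| <= C * e *+ 2 + M * h *+ 4.
Proof.
move=> ar h0 rb vr vb.
pose c := r + h; pose d := b - h *+ 2.
pose P s := step_from c h s - step_from d h s.
have ac : a < c by rewrite /c; lra.
have cd : c + h <= d by rewrite /c /d; lra.
have c2 : r + h *+ 2 = c + h by rewrite /c; ring.
have d1 : b - h = d + h by rewrite /d; ring.
have db : d + h < b by rewrite /d; lra.
have tP : test_function a b P by exact: step_diff_test_function.
have dP s : derive1 P s = derive1 (step_from c h) s - derive1 (step_from d h) s.
  have Hc := is_derive1 ((@derivable_n_step_from R c h 0%N).1 s).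
  have Hd := is_derive1 ((@derivable_n_step_from R d h 0%N).1 s).
  have [_ E] := is_deriveB Hc Hd.
  by rewrite derive1E; exact: E.
have ct (A : set R) (f : R -> R) : continuous f -> {within A, continuous f} by exact: continuous_subspaceT.
have := vg tP.
under eq_Rintegral do rewrite dP mulrBr.
have iv (c' : R) : lebesgue_measure.-integrable `]a, b[
    (EFin \o (fun s => v s * derive1 (step_from c' h) s)).
  apply: (@integrable_continuousM _ a b) => //.
  - by apply: ct; exact: continuous_derive1_step_from.
  - exact: subset_itv_oo_cc.
rewrite RintegralB//.
have Ar := @step_from_concentrates R C a b c h (v r) e v dC h0 ac _ cv _.
have Bb := @step_from_concentrates R C a b d h (v b) e v dC h0 _ db cv _.
have cb : c + h < b by lra.
have ad : a < d by lra.
have rp : r <= c + h by lra.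
have db' : d <= b by lra.
have db2 : d < b by lra.
have {}Ar := Ar cb (fun s sc => vr s (eq_ind_r (fun x => s \in `[c, x]) sc c2)).
have {}Bb := Bb ad (fun s sc => vb s (eq_ind_r (fun x => s \in `[d, x]) sc d1)).
have mP : measurable_fun setT P.
  apply: continuous_measurable_fun => s.
  by apply: cvgB; exact: continuous_step_from.
have P01 s : `|P s| <= 1 /\ `|1 - P s| <= 1.
  have /andP[c0 c1] := step_from_itv c h s; have /andP[d0 d1'] := step_from_itv d h s.
  rewrite !ler_norml; have [sd|ds] := leP s d.
    by rewrite /P (step_from0 h0 sd); split; apply/andP; split; lra.
  have cs : c + h <= s by lra.
  by rewrite /P (step_from1 h0 cs); split; apply/andP; split; lra.
have M0 : 0 <= M by rewrite (le_trans _ (gM 0)).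
have mg' (D : set (measurableTypeR R)) : measurable_fun D g by exact: measurable_funTS.
have mP' (D : set (measurableTypeR R)) : measurable_fun D P by exact: measurable_funTS.
have rb_sub : `]r, b[%classic `<=` `[r, b] by exact: subset_itv_oo_cc.
have igP : lebesgue_measure.-integrable `]r, b[ (EFin \o (fun s => g s * P s)).
  apply: (@bounded_integrable_itv _ r b M) => //; first exact: measurable_funM.
  by move=> s _; rewrite normrM; apply: le_trans (gM s); rewrite ler_piMr//; exact: (P01 s).1.
have ig : lebesgue_measure.-integrable `]r, b[ (EFin \o g).
  by apply: (@bounded_integrable_itv _ r b M).
have EP : \int[lebesgue_measure]_(s in `]a, b[) (g s * P s) =
   \int[lebesgue_measure]_(s in `]r, b[) (g s * P s).
  apply: Rintegral_sub_support; first by apply: subset_itvr; rewrite bnd_simp.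
  move=> s; rewrite /= !in_itv/= => /andP[as_ sb] /negP; rewrite sb andbT -leNgt => sr.
  have sc : s <= c by rewrite (le_trans sr)// /c lerDl ltW.
  have sd : s <= d by rewrite (le_trans sc)// (le_trans _ cd)// lerDl ltW.
  by rewrite /P !step_from0// subrr mulr0.
rewrite EP => AB.
have gP : `|\int[lebesgue_measure]_(s in `]r, b[) g s - \int[lebesgue_measure]_(s in `]r, b[) (g s * P s)| <= M * h *+ 4.
  rewrite -RintegralB//.
  have Q s : `|g s - g s * P s| <= M.
    rewrite -[X in X - _]mulr1 -mulrBr normrM.
    by apply: le_trans (gM s); rewrite ler_piMr//; exact: (P01 s).2.
  have mQ (D : set (measurableTypeR R)) : measurable_fun D (fun s => g s - g s * P s).
    by apply: measurable_funB => //; exact: measurable_funM.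
  rewrite (@Rintegral_itv3 _ r b (c + h) d)//; last by apply: (@bounded_integrable_itv _ r b M).
  rewrite [X in _ + X + _](_ : _ = 0) ?addr0; last first.
    rewrite /Rintegral integral0_eq// => s; rewrite /= in_itv/= => /andP[cs sd].
    by rewrite /P (step_from0 h0 sd) (step_from1 h0 (ltW cs)) subr0 mulr1 subrr.
  have N1 := @le_norm_Rintegral_itv _ r (c + h) M _ false false rp M0 (mQ _) (fun s _ => Q s).
  have N2 := @le_norm_Rintegral_itv _ d b M _ false true db' M0 (mQ _) (fun s _ => Q s).
  rewrite (le_trans (ler_normD _ _))// (le_trans (lerD N1 N2))//.
  by rewrite -mulrDr -mulrnAr ler_wpM2l// /c /d (_ : _ + _ = h *+ 4)//; ring.
exact (approx_combine Ar Bb AB gP).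
Qed.

(** Let [h] tend to 0 in the estimate, using continuity of [v] at both ends. *)
Lemma weak_FTC r : a <= r -> r < b ->
  \int[lebesgue_measure]_(s in `]r, b[) g s = v b - v r.
Proof.
move=> ar rb; apply/eqP; rewrite -subr_eq0 -normr_eq0 eq_le normr_ge0 andbT.
have C0 : 0 <= C by rewrite (le_trans _ (dC 0)).
have M0 : 0 <= M by rewrite (le_trans _ (gM 0)).
apply/ler_addgt0Pl => e e0; rewrite addr0.
pose e1 := e / (4 * (C + 1)).
have e10 : 0 < e1 by rewrite divr_gt0// mulr_gt0// ltr_wpDl.
have near_v x : a <= x -> x <= b -> exists2 d, 0 < d &
    forall s, a <= s -> s <= b -> `|s - x| <= d -> `|v s - v x| <= e1.
  move=> ax xb; have /subspace_continuousP := cv.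
  have xab : `[a, b]%classic x by rewrite /= in_itv/= ax.
  move=> /(_ x xab) /cvgrPdist_le /(_ e1 e10).
  rewrite /within /= => /nbhs_ballP[d /= d0 dP]; exists (d / 2); first by rewrite divr_gt0.
  move=> s as_ sb sx; rewrite distrC; apply: dP; last by rewrite in_itv/= as_.
  rewrite -ball_normE /ball_/= distrC (le_lt_trans sx)//; lra.
have [d1 d10 d1P] := near_v r ar (ltW rb).
have [d2 d20 d2P] := near_v b (le_trans ar (ltW rb)) (lexx _).
(* The edges of the plateau lie where [v] is close to its end values, they do
   not overlap, and [4 * M * h] is at most half of [e]. *)
pose h := Num.min (Num.min (d1 / 2) (d2 / 2)) (Num.min ((b - r) / 5) (e / (8 * (M + 1)))).
have h0 : 0 < h.
  rewrite !lt_min !divr_gt0//= ?subr_gt0//= mulr_gt0// ltr_wpDl//.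
have : h <= h by [].
rewrite {2}/h !le_min => /andP[/andP[hd1 hd2] /andP[hbr hM]].
have hr4 : r + h *+ 4 < b by lra.
have V1 s : s \in `[r + h, r + h *+ 2] -> `|v s - v r| <= e1.
  rewrite in_itv/= => /andP[s1 s2]; apply: d1P; [lra|lra|].
  by rewrite ler_norml; apply/andP; split; lra.
have V2 s : s \in `[b - h *+ 2, b - h] -> `|v s - v b| <= e1.
  rewrite in_itv/= => /andP[s1 s2]; apply: d2P; [lra|lra|].
  by rewrite ler_norml; apply/andP; split; lra.
apply: le_trans (weak_FTC_estimate ar h0 hr4 V1 V2) _.
have H1 : e1 * (4 * (C + 1)) = e.
  by rewrite /e1 divfK// gt_eqF// mulr_gt0// ltr_wpDl.
have H2 : h * (8 * (M + 1)) <= e.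
  by rewrite -ler_pdivlMr// mulr_gt0// ltr_wpDl.
lra.
Qed.
End weak_FTC.

(** * Integration by parts against a singular kernel *)

(** By exhaustion from inside: the integral over each compact subinterval is an
    increment of the nondecreasing function [F], hence at most [F b - F a]. Here
    [f] may be unbounded at either end. *)
Lemma ge0_improper_integrable (R : realType) (f F : R -> R) (a b : R) : a < b ->
  {within `[a, b], continuous F} ->
  (forall x, x \in `]a, b[ -> is_derive x (1 : R) F (f x)) ->
  (forall x, x \in `]a, b[ -> 0 <= f x) ->
  {in `]a, b[, continuous f} ->
  lebesgue_measure.-integrable `]a, b[ (EFin \o f).
Proof.
move=> ab cF dF f0 cf.
have mf : measurable_fun (`]a, b[%classic : set (measurableTypeR R)) f.
  apply: open_continuous_measurable_fun => // x; rewrite inE; exact: cf.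
pose p (n : nat) : R := a + (b - a) / n.+3%:R.
pose q (n : nat) : R := b - (b - a) / n.+3%:R.
have ba0 : 0 < b - a by rewrite subr_gt0.
have small (n : nat) : 0 < (b - a) / n.+3%:R /\ (b - a) / n.+3%:R * 3 <= b - a.
  split; first by rewrite divr_gt0.
  by rewrite mulrAC ler_pdivrMr// ler_pM2l// ler_nat.
have ap n : a < p n by rewrite ltrDl; exact: (small n).1.
have qb n : q n < b by rewrite gtrDl oppr_lt0; exact: (small n).1.
have pq n : p n < q n by have [s1 s2] := small n; rewrite /p /q; move: s1 s2 ba0; move: (_ / _) => k; lra.
pose S n : set (measurableTypeR R) := `[p n, q n]%classic.
have Sab n : S n `<=` `]a, b[ by apply: subset_itv; rewrite bnd_simp.
have Sn : nondecreasing_seq S.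
  move=> m n mn; apply/subsetPset; apply: subset_itvScc.
    by rewrite bnd_simp lerD2l ler_pM2l// lef_pV2 ?posrE ?ltr0n// ler_nat.
  by rewrite bnd_simp lerD2l lerN2 ler_pM2l// lef_pV2 ?posrE ?ltr0n// ler_nat.
have US : \bigcup_n S n = `]a, b[%classic.
  apply/seteqP; split; first by move=> x [n _]; exact: Sab.
  move=> x; rewrite /= in_itv/= => /andP[ax xb].
  pose m := Num.min (x - a) (b - x).
  have m0 : 0 < m by rewrite lt_min !subr_gt0 ax.
  have [n _ /(_ n (leqnn n)) nm] : \forall n \near \oo, (b - a) / n.+3%:R <= m.
    near=> n; rewrite ler_pdivrMr// mulrC -ler_pdivrMr//.
    apply: (@le_trans _ _ n%:R); last by rewrite ler_nat -addn3 leq_addr.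
    by near: n; exact: nbhs_infty_ger.
  move: nm; rewrite /m le_min => /andP[n1 n2].
  by exists n => //=; rewrite /S /= in_itv/= /p /q -lerBrDl n1 lerBrDr -lerBrDl.
have int_le n : (\int[lebesgue_measure]_(x in S n) (f x)%:E <= (F b - F a)%:E)%E.
  have Fd x : x \in `]p n, q n[ -> x \in `]a, b[.
    by rewrite !in_itv/= => /andP[? ?]; rewrite (lt_trans (ap n))//= (lt_trans _ (qb n)).
  have cFpq : {within `[p n, q n], continuous F}.
    apply: continuous_subspaceW cF; apply: subset_trans (Sab n) _; exact: subset_itv_oo_cc.
  have /(continuous_within_itvP _ (pq n)) [_ Fp Fq] := cFpq.
  rewrite (@continuous_FTC2 _ f F)//; first last.
  - by move=> x /Fd /dF [_ <-]; rewrite derive1E.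
  - by split=> // x /Fd /dF [].
  - apply: continuous_in_subspaceT => x /set_mem /Sab; exact: cf.
  have Fmono : {in `[a, b] &, {homo F : x y / x <= y >-> x <= y}}.
    apply: ger0_derive1_le_cc => // [x /dF[]//|x xab].
    by rewrite derive1E; have [_ ->] := dF _ xab; exact: f0.
  rewrite -EFinB lee_fin lerB//.
    by apply: Fmono; rewrite ?in_itv/= ?lexx ?(ltW ab)//= ?ltW// (lt_trans (ap n)).
  by apply: Fmono; rewrite ?in_itv/= ?lexx ?(ltW ab)//= ?ltW// (lt_trans _ (qb n)).
apply/integrableP; split; first exact/measurable_EFinP.
rewrite (eq_integral (fun x : measurableTypeR R => (f x)%:E)); last first.
  by move=> x /set_mem xab /=; rewrite ger0_norm//; exact: f0.
rewrite -US.
have mS n : measurable (S n) by exact: measurable_itv.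
have cvgS := @ge0_nondecreasing_set_cvg_integral _ _ _ S (EFin \o f) lebesgue_measure Sn mS.
have mfS i : measurable_fun (S i) (EFin \o f).
  by apply/measurable_EFinP; apply: measurable_funS mf => //; exact: Sab.
have f0S i x : S i x -> (0 <= (EFin \o f) x)%E.
  by move=> /Sab xab; rewrite lee_fin; exact: f0.
have {}cvgS := cvgS mfS f0S.
rewrite -(cvg_lim _ cvgS)//.
apply: (@le_lt_trans _ _ (F b - F a)%:E); last by rewrite ltry.
apply: lime_le; first by apply/cvg_ex; eexists; exact: cvgS.
by apply: nearW => n; exact: int_le.
Unshelve. all: by end_near. Qed.

(** The absolute value makes the primitives of singular powers continuous on the
    whole line, including the singular point. *)
Lemma continuous_normr_powR (R : realType) (p : R) : 0 < p ->
  continuous (fun x : R => `|x| `^ p).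
Proof.
move=> p0 x; have [->|x0] := eqVneq x 0.
  rewrite /continuous_at normr0 powR0 ?gt_eqF//.
  apply/cvgrPdist_le => e e0; near=> y.
  rewrite sub0r normrN ger0_norm ?powR_ge0//.
  have -> : e = (e `^ p^-1) `^ p by rewrite -powRrM mulVf ?gt_eqF// powRr1// ltW.
  apply: ge0_ler_powR; rewrite ?nnegrE ?powR_ge0 ?(ltW p0)//.
  near: y; exists (e `^ p^-1) => /=; first exact: powR_gt0.
  by move=> y /=; rewrite sub0r normrN => /ltW.
apply: (@continuous_comp _ _ _ (fun x : R => `|x|) (fun x => x `^ p)).
  exact: norm_continuous.
apply: differentiable_continuous; apply/derivable1_diffP.
by apply: derivable_powR; rewrite in_itv/= andbT normr_gt0.
Unshelve. all: by end_near. Qed.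

Lemma is_derive_powR_pos (R : realType) (p x : R) : 0 < x ->
  is_derive x (1 : R) (fun x : R => x `^ p) (p * x `^ (p - 1)).
Proof.
move=> x0; have xi : x \in `]0, +oo[ by rewrite in_itv/= andbT.
apply: DeriveDef; first exact: derivable_powR.
by rewrite -derive1E powR_derive1.
Qed.

Lemma is_derive_powR_sub (R : realType) (p t s : R) : s < t ->
  is_derive s (1 : R) (fun s : R => (t - s) `^ p) (- (p * (t - s) `^ (p - 1))).
Proof.
move=> st; have ts : 0 < - 1 * s + t by rewrite mulN1r addrC subr_gt0.
have := is_derive_affine (is_derive_powR_pos p ts).
rewrite mulN1r.
have -> : (fun s : R => (-1 * s + t) `^ p) = (fun s : R => (t - s) `^ p).
  by apply/funext => x; rewrite mulN1r addrC.
by rewrite mulN1r [- s + t]addrC.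
Qed.

(** [w] is a kernel, singular at [t] in the application, with derivative
    [w' >= 0], and [G r] is the integral of the bounded density [g] over
    the times after [r]. *)
Section parts.
Variables (R : realType) (e t M : R) (w w' g G : R -> R).
Hypothesis et : e < t.
Hypothesis dw : forall s, e <= s -> s < t -> is_derive s (1 : R) w (w' s).
Hypothesis cw' : forall s, e <= s -> s < t -> {for s, continuous w'}.
Hypothesis w'0 : forall s, e <= s -> s < t -> 0 <= w' s.
Hypothesis iw : lebesgue_measure.-integrable `]e, t[ (EFin \o w).
Hypothesis mg : measurable_fun setT g.
Hypothesis gM : forall s, `|g s| <= M.
Hypothesis gG : forall r, e <= r -> r < t -> \int[lebesgue_measure]_(s in `]r, t[) g s = G r.

Local Notation mu := (@lebesgue_measure R).

(** The integrand in the triangle [e < r < s < t], over which the order of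
    integration is exchanged. *)
Let kern (r s : R) : R := if r < s then (w' \_ `]e, t[) r else 0.
Let g0 := g \_ `]e, t[.

Lemma integral_dkernel (c s : R) : e < s -> s < t ->
  (\int[mu]_(r in `]e, s[) (w' r * c)%:E = (c * (w s - w e))%:E)%E.
Proof.
move=> es st.
have inst x : x \in `[e, s] -> e <= x /\ x < t.
  by rewrite in_itv/= => /andP[ex xs]; split=> //; exact: le_lt_trans st.
have cw'es : {within `[e, s], continuous (fun r => w' r * c)}.
  apply: continuous_in_subspaceT => x /set_mem /inst [ex xt].
  by apply: cvgM; [exact: cw'|exact: cvg_cst].
have dwc x : x \in `[e, s] -> is_derive x (1 : R) (fun x => c * w x) (w' x * c).
  move=> /inst [ex xt]; rewrite mulrC; apply: is_deriveZ; exact: dw.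
have cwc : {within `[e, s], continuous (fun x => c * w x)}.
  by apply: derivable_within_continuous => x /dwc [].
have /(continuous_within_itvP _ es) [_ w1 w2] := cwc.
rewrite integral_itv_bndo_bndc; last first.
  apply/measurable_EFinP; apply: open_continuous_measurable_fun => // x.
  rewrite inE/= in_itv/= => /andP[ex xs]; apply: cvgM; last exact: cvg_cst.
  by apply: cw'; [exact: ltW|exact: lt_trans st].
rewrite integral_itv_obnd_cbnd; last first.
  apply/measurable_EFinP; apply/measurable_fun_itv_bndo_bndcP.
  apply: open_continuous_measurable_fun => // x.
  rewrite inE/= in_itv/= => /andP[ex xs]; apply: cvgM; last exact: cvg_cst.
  by apply: cw'; [exact: ltW|exact: lt_trans st].
rewrite (@continuous_FTC2 _ _ (fun x => c * w x))//.
- by rewrite -EFinB mulrBr.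
- by split=> // x xes; have [] := dwc x (subset_itv_oo_cc xes).
- by move=> x xes; rewrite derive1E; have [_ ->] := dwc x (subset_itv_oo_cc xes).
Qed.

Lemma integral_kern_past (c s : R) : s \in `]e, t[ ->
  (\int[mu]_r (kern r s * c)%:E = (c * (w s - w e))%:E)%E.
Proof.
rewrite in_itv/= => /andP[es st]; rewrite -(integral_dkernel c es st) [RHS]integral_mkcond.
apply: eq_integral => r _; rewrite /kern !patchE.
have [rs|sr] := ltP r s; last first.
  by rewrite mul0r ifF//; apply/negP => /set_mem; rewrite /= in_itv/= [_ < s]ltNge sr andbF.
have [er|re] := ltP e r.
  by rewrite !ifT// inE/= in_itv/= er// (lt_trans rs).
by rewrite !ifF ?mul0r//; apply/negP => /set_mem; rewrite /= in_itv/= ltNge re.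
Qed.

Lemma integrable_density r : e <= r -> mu.-integrable `]r, t[ (EFin \o g).
Proof.
move=> er; apply: (@bounded_integrable_itv _ r t M) => //.
- exact: subset_itv_oo_cc.
- exact: measurable_funTS.
Qed.

Lemma integral_kern_future r :
  (\int[mu]_s (kern r s * g0 s)%:E = (((fun r => w' r * G r) \_ `]e, t[) r)%:E)%E.
Proof.
have [rt|rt] := boolP (r \in `]e, t[); last first.
  have rt' : (r \in `]e, t[%classic) = false by apply/negP => /set_mem; exact/negP.
  rewrite integral0_eq ?patchE ?rt'// => s _.
  by rewrite /kern patchE rt'; case: ifP; rewrite mul0r.
have rt' : r \in `]e, t[%classic by rewrite inE.
rewrite patchE rt'; move: (rt); rewrite in_itv/= => /andP[er rlt].
rewrite -gG ?(ltW er)//.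
rewrite /Rintegral -[X in (X * _)%:E]/(fine (w' r)%:E) -fineM//; last first.
  by apply: integrable_fin_num => //; apply: integrable_density; exact: ltW.
rewrite fineK; last first.
  rewrite fin_numM//; apply: integrable_fin_num => //; apply: integrable_density; exact: ltW.
rewrite -integralZl//; last by apply: integrable_density; exact: ltW.
rewrite [RHS]integral_mkcond; apply: eq_integral => s _.
rewrite /kern /g0 !patchE rt'.
have [rs|sr] := ltP r s; last first.
  by rewrite mul0r ifF//; apply/negP => /set_mem; rewrite /= in_itv/= ltNge sr.
have [st|ts] := ltP s t.
  by rewrite !ifT ?inE/= ?in_itv/= ?rs ?st ?(lt_trans er)//.
by rewrite !ifF ?mulr0//; apply/negP => /set_mem; rewrite /= in_itv/= [_ < t]ltNge ts andbF.
Qed.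

Lemma measurable_kern :
  measurable_fun setT (fun z : measurableTypeR R * measurableTypeR R => kern z.1 z.2).
Proof.
apply: measurable_fun_ifT => //.
  by apply: measurable_fun_ltr; [exact: measurable_fst|exact: measurable_snd].
apply: measurableT_comp; last exact: measurable_fst.
apply/(measurable_restrictT w') => //.
apply: open_continuous_measurable_fun => // x.
by rewrite inE/= in_itv/= => /andP[ex xt]; apply: cw' => //; exact: ltW.
Qed.

Let mI : measurable (`]e, t[%classic : set (measurableTypeR R)).
Proof. exact: measurable_itv. Qed.

Let f (z : measurableTypeR R * measurableTypeR R) : \bar R := (kern z.1 z.2 * g0 z.2)%:E.

Lemma integrable_kernel_diff : mu.-integrable `]e, t[ (EFin \o (fun s => w s - w e)).
Proof.
have ic : mu.-integrable `]e, t[ (EFin \o (cst (w e))).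
  apply: (@bounded_integrable_itv _ e t `|w e|) => //; exact: subset_itv_oo_cc.
exact: (integrableB mI iw ic).
Qed.

Lemma integrable_density_kernel : mu.-integrable `]e, t[ (EFin \o (fun s => g s * (w s - w e))).
Proof.
have iM : mu.-integrable `]e, t[ (fun s => (M * (w s - w e))%:E).
  exact: (integrableZl mI M integrable_kernel_diff).
apply: (le_integrable mI _ _ iM).
  apply/measurable_EFinP; apply: measurable_funM; first exact: measurable_funTS.
  by apply/measurable_EFinP; have /integrableP[] := integrable_kernel_diff.
move=> s _ /=; rewrite lee_fin !normrM ler_wpM2r//.
by rewrite (le_trans (gM s))// ler_norm.
Qed.

Lemma kernel_increment_ge0 s : s \in `]e, t[ -> 0 <= w s - w e.
Proof.
rewrite in_itv/= => /andP[es st]; have := integral_dkernel 1 es st.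
rewrite mul1r -lee_fin => <-; apply: integral_ge0 => r /=.
rewrite in_itv/= => /andP[er rs]; rewrite mulr1 lee_fin.
by apply: w'0; [exact: ltW|exact: lt_trans st].
Qed.

Lemma kern_ge0 r s : 0 <= kern r s.
Proof.
rewrite /kern; case: ifP => // _; rewrite patchE; case: ifP => // /set_mem /=.
by rewrite in_itv/= => /andP[er rt]; apply: w'0 => //; exact: ltW.
Qed.

Let integral_kern_g s : (\int[mu]_r (kern r s * g0 s)%:E =
  ((fun s => g s * (w s - w e)) \_ `]e, t[ s)%:E)%E.
Proof.
rewrite /g0 !patchE; case: ifPn => [/set_mem st|_]; first exact: integral_kern_past.
by rewrite integral0_eq// => r _; rewrite mulr0.
Qed.

(** Integrating first over [r], where the kernel is nonnegative, leaves
    [|g s| * (w s - w e)], which is integrable since [g] is bounded. *)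
Lemma integrable_kern : (mu \x mu)%E.-integrable setT f.
Proof.
have mf : measurable_fun setT f.
  apply/measurable_EFinP; apply: measurable_funM; first exact: measurable_kern.
  apply: measurableT_comp; last exact: measurable_snd.
  by apply/(measurable_restrictT g) => //; exact: measurable_funTS.
have [_ I21] := @integrable21ltyP _ _ _ _ R mu mu f mf.
apply I21.
rewrite (@eq_integral _ (measurableTypeR R) _ _ _ ((fun s => `|g s * (w s - w e)|%:E) \_ `]e, t[)); last first.
  move=> s _; rewrite /f/= /g0 !patchE; case: ifPn => [/set_mem st|st].
    rewrite normrM (ger0_norm (kernel_increment_ge0 st)) -(integral_kern_past _ st).
    by apply: eq_integral => r _; rewrite normrM (ger0_norm (kern_ge0 _ _)).
  by rewrite integral0_eq// => r _; rewrite mulr0 normr0.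
rewrite -integral_mkcond.
by have /integrableP[_] := integrable_density_kernel.
Qed.

Lemma integrable_dkernel_increment : mu.-integrable `]e, t[ (EFin \o (fun r => w' r * G r)).
Proof.
apply/(integrable_mkcond _ mI).
have := integrable_fubini_F integrable_kern.
apply: eq_integrable => // r _.
by rewrite /fubini_F /f/= integral_kern_future restrict_EFin.
Qed.

Lemma Rintegral_kern_swap :
  \int[mu]_(s in `]e, t[) (g s * (w s - w e)) = \int[mu]_(r in `]e, t[) (w' r * G r).
Proof.
have := Fubini integrable_kern.
rewrite /f /=; under eq_integral do rewrite integral_kern_future.
under [X in _ = X -> _]eq_integral do rewrite integral_kern_g.
move=> E; rewrite Rintegral_mkcond [RHS]Rintegral_mkcond; congr fine.
exact: esym E.
Qed.

(** Write [w s = w e + int_e^s w'] and exchange the order of integration. This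
    stays valid when [w] is unbounded at [t]. *)
Lemma Rintegral_kernel_by_parts :
  \int[mu]_(s in `]e, t[) (w s * g s) = w e * G e + \int[mu]_(r in `]e, t[) (w' r * G r).
Proof.
have ig : mu.-integrable `]e, t[ (EFin \o (fun s => w e * g s)).
  exact: (integrableZl mI (w e) (integrable_density (lexx e))).
rewrite -Rintegral_kern_swap -gG// -RintegralZl//; last exact: integrable_density.
rewrite -RintegralD//; last exact: integrable_density_kernel.
by apply: eq_Rintegral => s _; ring.
Qed.
End parts.

(** * The Caputo derivative of a function that is maximal at the final time *)

Section caputo_kernel.
Variables (R : realType) (alpha t : R).
Hypothesis alpha01 : 0 < alpha < 1.
Local Notation mu := (@lebesgue_measure R).

Definition caputo_kernel (s : R) : R := (t - s) `^ (- alpha).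
Definition caputo_dkernel (s : R) : R := alpha * (t - s) `^ (- alpha - 1).

Lemma is_derive_caputo_kernel s : s < t ->
  is_derive s (1 : R) caputo_kernel (caputo_dkernel s).
Proof.
move=> st; rewrite /caputo_dkernel -[X in is_derive _ _ _ X]opprK -mulNr.
have := is_derive_powR_sub (- alpha) st.
by rewrite mulNr opprK.
Qed.

Lemma continuous_caputo_dkernel s : s < t -> {for s, continuous caputo_dkernel}.
Proof.
move=> st; have [d _] := is_derive_powR_sub (- alpha - 1) st.
have c : {for s, continuous (fun s => (t - s) `^ (- alpha - 1))}.
  by apply: differentiable_continuous; apply/derivable1_diffP.
by apply: cvgM; [exact: cvg_cst|exact: c].
Qed.

Lemma caputo_dkernel_ge0 s : 0 <= caputo_dkernel s.
Proof. by have /andP[a0 _] := alpha01; rewrite mulr_ge0 ?powR_ge0// ltW. Qed.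

Lemma integrable_caputo_kernel e : e < t -> mu.-integrable `]e, t[ (EFin \o caputo_kernel).
Proof.
move=> et; have /andP[a0 a1] := alpha01.
have a1' : 0 < 1 - alpha by rewrite subr_gt0.
apply: (@ge0_improper_integrable _ _ (fun s => - (1 - alpha)^-1 * `|t - s| `^ (1 - alpha)) e t et).
- apply: continuous_subspaceT => s; apply: cvgM; first exact: cvg_cst.
  apply: (@continuous_comp _ _ _ (fun s => t - s) (fun x => `|x| `^ (1 - alpha))).
    by apply: cvgB; [exact: cvg_cst|exact: cvg_id].
  exact: continuous_normr_powR.
- move=> s; rewrite in_itv/= => /andP[es st].
  apply: (@near_eq_is_derive R R R (fun s => - (1 - alpha)^-1 * (t - s) `^ (1 - alpha))).
    near=> y; congr (_ * _ `^ _); rewrite ger0_norm// subr_ge0; apply/ltW.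
    by near: y; exact: lt_nbhsl.
  have := is_deriveZ (- (1 - alpha)^-1) (is_derive_powR_sub (1 - alpha) st).
  rewrite /GRing.scale/= mulrNN mulrA mulVf ?gt_eqF// mul1r.
  by rewrite (_ : 1 - alpha - 1 = - alpha)//; ring.
- by move=> s _; exact: powR_ge0.
- move=> s; rewrite in_itv/= => /andP[es st].
  have [d _] := is_derive_caputo_kernel st.
  by apply: differentiable_continuous; apply/derivable1_diffP.
Unshelve. all: by end_near. Qed.

(** The right-hand side does not depend on the representative of the weak
    derivative, which the left-hand side chooses anew for each [e]. *)
Lemma caputo_integral_by_parts (e : R) (v : R -> R) : e < t ->
  {within `[e, t], continuous v} -> W1oo e t v ->
  mu.-integrable `]e, t[ (EFin \o (fun r => caputo_dkernel r * (v t - v r))) /\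
  \int[mu]_(s in `]e, t[) ((t - s) `^ (- alpha) * weak_deriv e t v s) =
  caputo_kernel e * (v t - v e) +
  \int[mu]_(r in `]e, t[) (caputo_dkernel r * (v t - v r)).
Proof.
move=> et cv [_ exg].
have [Lg wg] : is_weak_deriv e t v (weak_deriv e t v) := xgetPex (cst 0) exg.
have [g [M [mg gM gE]]] := Loo_bounded_repr Lg.
have mI : measurable (`]e, t[%classic : set (measurableTypeR R)) by exact: measurable_itv.
have [C C0 dC] := derive1_smooth_step_bounded R.
have vg phi : test_function e t phi ->
    \int[mu]_(s in `]e, t[) (v s * derive1 phi s) = - \int[mu]_(s in `]e, t[) (g s * phi s).
  move=> tp; rewrite (wg _ tp) gE//.
  apply: measurable_funTS; apply: continuous_measurable_fun => s.
  by apply: differentiable_continuous; apply/derivable1_diffP; exact: (tp.1 0%N).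
have gG r : e <= r -> r < t -> \int[mu]_(s in `]r, t[) g s = v t - v r.
  exact: (weak_FTC dC cv mg gM vg).
have dw s : e <= s -> s < t -> is_derive s (1 : R) caputo_kernel (caputo_dkernel s).
  by move=> _; exact: is_derive_caputo_kernel.
have cw s : e <= s -> s < t -> {for s, continuous caputo_dkernel}.
  by move=> _; exact: continuous_caputo_dkernel.
have w0 s : e <= s -> s < t -> 0 <= caputo_dkernel s.
  by move=> _ _; exact: caputo_dkernel_ge0.
have iw := integrable_caputo_kernel et.
split; first exact: (integrable_dkernel_increment dw cw w0 iw mg gM gG).
rewrite -(Rintegral_kernel_by_parts et dw cw w0 iw mg gM gG).
under eq_Rintegral do rewrite mulrC.
rewrite gE//; first by apply: eq_Rintegral => s _; rewrite mulrC.
by have /integrableP[/measurable_EFinP] := iw.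
Qed.

End caputo_kernel.

Section caputo_bound.
Variables (R : realType) (alpha t m : R) (v : R -> R).
Hypothesis alpha01 : 0 < alpha < 1.
Hypothesis m0 : 0 < m.
Hypothesis mt : m < t.
Hypothesis cv : {within `[0, t], continuous v}.
Hypothesis Wv : forall e, 0 < e -> e < t -> W1oo e t v.
Local Notation mu := (@lebesgue_measure R).
Local Notation w := (caputo_kernel alpha t).
Local Notation w' := (caputo_dkernel alpha t).

Let k r := w' r * (v t - v r).
Let J e := \int[mu]_(s in `]e, t[) ((t - s) `^ (- alpha) * weak_deriv e t v s).

Let by_parts e : 0 < e -> e < t ->
  mu.-integrable `]e, t[ (EFin \o k) /\
  J e = w e * (v t - v e) + \int[mu]_(r in `]e, t[) k r.
Proof.
move=> e0 et; apply: (caputo_integral_by_parts alpha01 et _ (Wv e0 et)).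
by apply: continuous_subspaceW cv; apply: subset_itvr; rewrite bnd_simp ltW.
Qed.

Let split_m e : 0 < e -> e < m ->
  J e = w e * (v t - v e) + \int[mu]_(r in `]e, m]) k r + \int[mu]_(r in `]m, t[) k r.
Proof.
move=> e0 em; have [ik ->] := by_parts e0 (lt_trans em mt).
have := @Rintegral_itvB R k (BRight e) (BLeft t) m ik (ltW em) mt.
by rewrite -addrA => <-; congr (_ + _); rewrite addrC subrK.
Qed.

Let integrable_k : mu.-integrable `[0, m] (EFin \o k).
Proof.
apply: continuous_compact_integrable; first exact: segment_compact.
apply: (@continuous_subspaceW _ _ _ `[0, m]%classic); first by [].
have c1 : {within `[0, m], continuous w'}.
  apply: continuous_in_subspaceT => s /set_mem; rewrite /= in_itv/= => /andP[_ sm].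
  by apply: continuous_caputo_dkernel; exact: le_lt_trans mt.
have c2 : {within `[0, m], continuous v}.
  by apply: continuous_subspaceW cv; apply: subset_itvl; rewrite bnd_simp ltW.
move=> s; apply: cvgM; first exact: c1.
by apply: cvgB; [exact: cvg_cst|exact: c2].
Qed.

Let continuous_w s : s < t -> {for s, continuous w}.
Proof.
move=> st; have [d _] := is_derive_caputo_kernel alpha st.
by apply: differentiable_continuous; apply/derivable1_diffP.
Qed.

(** Only the part of the integral near 0 varies with [e]; there the kernel is
    regular and [v] is continuous. *)
Lemma is_cvg_caputo : cvg (J e @[e --> 0^'+]).
Proof.
have t0 : 0 < t := lt_trans m0 mt.
have /(continuous_within_itvP _ t0) [_ v0 _] := cv.
have int0 : \int[mu]_(r in `[0, e]) k r @[e --> 0^'+] --> (0 : R).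
  apply: cvg_at_right_filter; exact: (parameterized_integral_cvg_left m0 integrable_k).
apply/cvg_ex; exists (w 0 * (v t - v 0) + (\int[mu]_(r in `[0, m]) k r - 0)
   + \int[mu]_(r in `]m, t[) k r).
apply: (@cvg_trans _ ((w e * (v t - v e) + (\int[mu]_(r in `[0, m]) k r -
   \int[mu]_(r in `[0, e]) k r) + \int[mu]_(r in `]m, t[) k r) @[e --> 0^'+])).
  apply: near_eq_cvg; near=> e.
  have e0 : 0 < e by [].
  have em : e < m by near: e; exact: nbhs_right_lt.
  rewrite (split_m e0 em); congr (_ + _ + _).
  by rewrite (@Rintegral_itvB R k (BLeft 0) (BRight m) e integrable_k)// bnd_simp ltW.
apply: cvgD; last exact: cvg_cst.
apply: cvgD.
  apply: cvgM.
    apply: cvg_at_right_filter; exact: continuous_w.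
  by apply: cvgB; [exact: cvg_cst|exact: v0].
by apply: cvgB; [exact: cvg_cst|exact: int0].
Unshelve. all: by end_near. Qed.

Hypothesis vt : forall r, 0 <= r -> r <= t -> v r <= v t.
Hypothesis vm : forall r, 0 <= r -> r <= m -> v r <= v t / 2.

Let J_ge e : 0 < e -> e < m -> v t / 2 * w m <= J e.
Proof.
move=> e0 em; rewrite (split_m e0 em).
have k1 : 0 <= \int[mu]_(r in `]m, t[) k r.
  apply: Rintegral_ge0 => r; rewrite /= in_itv/= => /andP[mr rt].
  rewrite mulr_ge0 ?caputo_dkernel_ge0// subr_ge0 vt//; last exact: ltW.
  by rewrite ltW// (lt_trans m0).
have dw s : e <= s -> s < t -> is_derive s (1 : R) w (w' s).
  by move=> _; exact: is_derive_caputo_kernel.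
have cw s : e <= s -> s < t -> {for s, continuous w'}.
  by move=> _; exact: continuous_caputo_dkernel.
have Ew := integral_dkernel dw cw (v t / 2) em mt.
have sub : (`]e, m[%classic : set (measurableTypeR R)) `<=` `[0, m]%classic.
  by apply: subset_itvScc; rewrite bnd_simp// ltW.
have ik : mu.-integrable `]e, m[ (EFin \o k).
  by refine (integrableS _ _ sub integrable_k); exact: measurable_itv.
have iw : mu.-integrable `]e, m[ (EFin \o (fun r => w' r * (v t / 2))).
  refine (integrableS _ _ sub _); try exact: measurable_itv.
  apply: continuous_compact_integrable; first exact: segment_compact.
  apply: continuous_in_subspaceT => s /set_mem; rewrite /= in_itv/= => /andP[_ sm].
  apply: cvgM; last exact: cvg_cst.
  by apply: continuous_caputo_dkernel; exact: le_lt_trans mt.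
have k2 : v t / 2 * (w m - w e) <= \int[mu]_(r in `]e, m]) k r.
  rewrite -Rintegral_itv_bndo_bndc//.
  have -> : v t / 2 * (w m - w e) = \int[mu]_(r in `]e, m[) (w' r * (v t / 2)).
    by rewrite /Rintegral Ew.
  apply: le_Rintegral => // r; rewrite /= in_itv/= => /andP[er rm].
  rewrite ler_wpM2l ?caputo_dkernel_ge0//.
  have : v r <= v t / 2 by apply: vm; rewrite ltW// (lt_trans e0).
  lra.
have k3 : w e * (v t / 2) <= w e * (v t - v e).
  rewrite ler_wpM2l ?powR_ge0//.
  have : v e <= v t / 2 by apply: vm; rewrite ltW.
  lra.
have -> : v t / 2 * w m = w e * (v t / 2) + v t / 2 * (w m - w e) + 0 by ring.
by rewrite !lerD.
Qed.

(** Drop the integral over the times after [m], and bound [v t - v r] from below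
    by [v t / 2] before [m]: the increments of the kernel then add up to its value
    at [m]. *)
Lemma caputo_ge : 0 < Gamma (1 - alpha) ->
  (Gamma (1 - alpha))^-1 * (v t / 2 * (t - m) `^ (- alpha)) <= caputo alpha v t.
Proof.
move=> G0; rewrite /caputo ler_pM2l ?invr_gt0//.
apply: limr_ge; first exact: is_cvg_caputo.
near=> e; apply: J_ge; first by [].
by near: e; exact: nbhs_right_lt.
Unshelve. all: by end_near. Qed.
End caputo_bound.

(** A divergent integral would have the value 0, so finiteness is the point: the
    power is integrable near 0 and the exponential at infinity. The integrand is
    at least [expR (- 1)] on the unit interval. *)
Lemma Gamma_gt0 (R : realType) (z : R) : 0 < z -> z <= 1 -> 0 < Gamma z.
Proof.
move=> z0 z1; rewrite /Gamma /Rintegral.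
set mu := (@lebesgue_measure R).
pose f (s : measurableTypeR R) : R := s `^ (z - 1) * expR (- s).
have f0 s : 0 <= f s by rewrite mulr_ge0 ?powR_ge0 ?expR_ge0.
have mf : measurable_fun setT f.
  apply: measurable_funM; first exact: measurable_powR.
  by apply: measurableT_comp => //; exact: measurable_expR.
have mfD (D : set (measurableTypeR R)) : measurable_fun D (EFin \o f).
  by apply/measurable_EFinP; exact: measurable_funTS.
pose A : set (measurableTypeR R) := `]0, 1[%classic.
pose B : set (measurableTypeR R) := `[1, +oo[%classic.
have mA : measurable A by exact: measurable_itv.
have mB : measurable B by exact: measurable_itv.
pose I0 : set (measurableTypeR R) := `]0, +oo[%classic.
have U : I0 = A `|` B.
  by rewrite /I0 /A /B -itv_bndbnd_setU// bnd_simp.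
have dAB : [disjoint A & B].
  apply/disj_setPS => s []; rewrite /A /B /= !in_itv/= => /andP[_ s1].
  by rewrite andbT leNgt s1.
have E : (\int[mu]_(s in I0) (f s)%:E =
   \int[mu]_(s in A) (f s)%:E + \int[mu]_(s in B) (f s)%:E)%E.
  by rewrite U ge0_integral_setU// => s _; rewrite lee_fin.
have Aoo : (\int[mu]_(s in A) (f s)%:E < +oo)%E.
  have iA : mu.-integrable A (EFin \o (fun s => s `^ (z - 1))).
    apply: (@ge0_improper_integrable _ _ (fun s => z^-1 * `|s| `^ z) 0 1 ltr01).
    - apply: continuous_subspaceT => s; apply: cvgM; first exact: cvg_cst.
      exact: continuous_normr_powR.
    - move=> s; rewrite in_itv/= => /andP[s0 s1].
      apply: (@near_eq_is_derive R R R (fun s => z^-1 * s `^ z)).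
        near=> y; congr (_ * _ `^ _); rewrite ger0_norm//; apply/ltW.
        by near: y; exact: lt_nbhsr.
      have := is_deriveZ z^-1 (is_derive_powR_pos z s0).
      by rewrite /GRing.scale/= mulrA mulVf ?gt_eqF// mul1r.
    - by move=> s _; exact: powR_ge0.
    - move=> s; rewrite in_itv/= => /andP[s0 s1].
      have [d _] := is_derive_powR_pos (z - 1) s0.
      by apply: differentiable_continuous; apply/derivable1_diffP.
  have /integrableP[mp] := iA; apply: le_lt_trans; apply: ge0_le_integral => //.
  - by move=> s _; rewrite lee_fin.
  - exact: measurableT_comp.
  - move=> s; rewrite /A /= in_itv/= => /andP[s0 _].
    rewrite lee_fin ger0_norm ?powR_ge0// ler_piMr ?powR_ge0//.
    by rewrite expR_le1 oppr_le0 ltW.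
have Boo : (\int[mu]_(s in B) (f s)%:E < +oo)%E.
  have dE s : is_derive s (1 : R) (fun s : R => - expR (- s)) (expR (- s)).
    have dN : is_derive s (1 : R) (fun s : R => - s) (- 1).
      exact: (is_deriveN (is_derive_id s (1 : R))).
    have := is_deriveN (@is_derive1_comp R expR (fun s : R => - s) s _ _ (is_derive_expR _) dN).
    by rewrite mulrN1 opprK.
  have cE : continuous (fun s : R => expR (- s)).
    move=> s; apply: (@continuous_comp _ _ _ (fun s : R => - s) expR).
      exact: continuousN.
    exact: continuous_expR.
  have EB : (\int[mu]_(s in B) (expR (- s))%:E = 0%:E - (- expR (- 1))%:E)%E.
    apply: (@ge0_continuous_FTC2y _ _ (fun s => - expR (- s))).
    - by move=> s _; exact: expR_ge0.
    - by apply: continuous_subspaceT; exact: cE.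
    - rewrite -oppr0; apply: cvgN; exact: cvgr_expR.
    - by move=> s _; case: (dE s).
    - apply: cvg_at_right_filter; apply: cvgN; exact: cE.
    - by move=> s _; rewrite derive1E; case: (dE s).
  apply: (@le_lt_trans _ _ (\int[mu]_(s in B) (expR (- s))%:E)%E); last by rewrite EB ltry.
  apply: ge0_le_integral => //.
  - by move=> s _; rewrite lee_fin.
  - by apply/measurable_EFinP; apply: measurable_funTS; exact: continuous_measurable_fun.
  - move=> s; rewrite /B /= in_itv/= andbT => s1.
    rewrite lee_fin ler_piMl ?expR_ge0//.
    by rewrite -[leRHS](powRr0 s); apply: ler_powR; rewrite ?subr_le0.
have Age : ((expR (- 1))%:E <= \int[mu]_(s in A) (f s)%:E)%E.
  have -> : ((expR (- 1))%:E = \int[mu]_(s in A) (expR (-1))%:E)%E.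
    have muA : mu A = 1%E.
      rewrite -[LHS]/(lebesgue_measure (`](0 : R), 1[%classic : set R)).
      by rewrite lebesgue_measure_itv/= lte_fin ltr01 oppr0 adde0.
    by rewrite integral_cst// -[X in (_ * X)%E]/(mu A) muA mule1.
  apply: ge0_le_integral => //.
  - move=> s; rewrite /A /= in_itv/= => /andP[s0 s1].
    rewrite lee_fin -[leLHS]mul1r ler_pM ?expR_ge0//.
      by rewrite -[leLHS](powRr0 s); apply: ger_powR; rewrite ?subr_le0// s0 ltW.
    by rewrite ler_expR lerN2 ltW.
have Bge : (0 <= \int[mu]_(s in B) (f s)%:E)%E by apply: integral_ge0 => s _; rewrite lee_fin.
rewrite [X in fine X](_ : _ = \int[mu]_(s in A) (f s)%:E + \int[mu]_(s in B) (f s)%:E)%E//.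
rewrite fine_gt0//; apply/andP; split; last by rewrite lte_add_pinfty.
by rewrite (lt_le_trans _ (leeD Age Bge))// adde0 lte_fin expR_gt0.
Unshelve. all: by end_near. Qed.

(** * Time derivatives at a maximum for an exponential weight *)

Lemma expRN_half (R : realType) (x : R) : 0 <= x -> x <= 1 -> expR (- x) <= 1 - x / 2.
Proof.
move=> x0 x1; have x10 : 0 < 1 + x by rewrite ltr_pwDl.
apply: (@le_trans _ _ (1 + x)^-1).
  by rewrite expRN lef_pV2 ?posrE ?expR_gt0//; exact: expR_ge1Dx.
rewrite -[leLHS]mul1r ler_pdivrMr//; nra.
Qed.

Lemma expRN1_half (R : realType) (x : R) : 1 <= x -> expR (- x) <= 1 / 2.
Proof.
move=> x1; apply: (@le_trans _ _ (expR (- 1))); first by rewrite ler_expR lerN2.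
by rewrite (le_trans (expRN_half ler01 (lexx _)))//; lra.
Qed.

Section exponential_maximum.
Variables (R : realType) (T d t : R) (v : R -> R).
Hypothesis d0 : 0 < d.
Hypothesis t0 : 0 < t.
Hypothesis tT : t <= T.
Hypothesis vt0 : 0 < v t.
Hypothesis vmax : forall s, 0 <= s -> s <= t -> v s <= expR (- ((t - s) / d)) * v t.

Let vle s : 0 <= s -> s <= t -> v s <= v t.
Proof.
move=> s0 st; rewrite (le_trans (vmax s0 st))// ler_piMl ?(ltW vt0)//.
by rewrite expR_le1 oppr_le0 divr_ge0 ?(ltW d0)// subr_ge0.
Qed.

(** The limit defining the derivative may be computed along times before [t],
    where the difference quotient is bounded by the decay of the exponential:
    [1 - expR (- x) >= x / 2] for [x] between 0 and 1. *)
Lemma time_deriv_ge : C1_time T v -> (2 * d)^-1 * v t <= time_deriv T v t.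
Proof.
move=> [cvgT _].
have tin : t \in `]0, T] by rewrite in_itv/= t0.
have dq : diff_quot v t s @[s --> t^'-] --> time_deriv T v t.
  apply: cvg_trans (cvgT t tin) => P.
  move=> PP.
  have {}PP : \forall s \near t, s != t -> s \in `]0, T] -> P (diff_quot v t s) by exact: PP.
  rewrite /fmap /= /nbhs /= /at_left /within /=; near=> s => st.
  suff H : s != t -> s \in `]0, T] -> P (diff_quot v t s).
    apply: H; first by rewrite lt_eqF.
    rewrite in_itv/= (le_trans (ltW st) tT) andbT; near: s; exact: lt_nbhsr.
  by near: s; exact: PP.
apply: (cvgr_to_ge dq); near=> s.
have st : s < t by [].
have s0 : 0 <= s by apply/ltW; near: s; exact: nbhs_left_gt.
have sd : t - s <= d.
  rewrite lerBlDr -lerBlDl; near: s; apply: nbhs_left_ge; by rewrite ltrBlDr ltrDl.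
have -> : diff_quot v t s = (v t - v s) / (t - s).
  by rewrite /diff_quot -opprB invrN mulNr -mulrN opprB mulrC.
have ts : 0 < t - s by rewrite subr_gt0.
rewrite ler_pdivlMr//.
have x1 : (t - s) / d <= 1 by rewrite ler_pdivrMr// mul1r.
have x0 : 0 <= (t - s) / d by rewrite divr_ge0// ltW.
have := vmax s0 (ltW st); have := ler_wpM2r (ltW vt0) (expRN_half x0 x1).
have -> : (2 * d)^-1 * v t * (t - s) = (t - s) / d / 2 * v t by rewrite invfM; ring.
move: (expR _ * _) => k; lra.
Unshelve. all: by end_near. Qed.

(** If [d < t], the values before [m = t - d] are at most [v t / 2] by the decay
    of the exponential. Otherwise continuity at 0, where [v] is nonpositive,
    provides such an [m], and [t - m <= d] again. *)
Lemma caputo_ge_max (alpha : R) : 0 < alpha < 1 -> v 0 <= 0 ->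
  {within `[0, t], continuous v} ->
  (forall e, 0 < e -> e < t -> W1oo e t v) ->
  (2 * Gamma (1 - alpha))^-1 * d `^ (- alpha) * v t <= caputo alpha v t.
Proof.
move=> a01 v00 cv Wv; have /andP[a0 a1] := a01.
have G0 : 0 < Gamma (1 - alpha) by apply: Gamma_gt0; [rewrite subr_gt0|rewrite gerBl ltW].
have [m [m0 mt md vm]] : exists m, [/\ 0 < m, m < t, t - m <= d &
    forall r, 0 <= r -> r <= m -> v r <= v t / 2].
  have [dt|td] := ltP d t.
    exists (t - d); split; [by rewrite subr_gt0|by rewrite ltrBlDr ltrDl|by rewrite subKr|].
    move=> r r0 rm; have rt : r <= t by rewrite (le_trans rm)// gerBl ltW.
    rewrite (le_trans (vmax r0 rt))// mulrC ler_wpM2l ?(ltW vt0)//.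
    rewrite -[leRHS]mul1r; apply: expRN1_half.
    by rewrite ler_pdivlMr// mul1r; lra.
  have /(continuous_within_itvP _ t0) [_ v0 _] := cv.
  have v00' : v 0 < v t / 2 by rewrite (le_lt_trans v00)// divr_gt0.
  have v0lt : \forall r \near (0 : R)^'+, v r < v t / 2 by exact: (cvgr_lt (v 0) v0).
  have /nbhs_ballP[e /= e0 eP] := v0lt.
  pose m := Num.min (e / 2) (t / 2).
  have m0 : 0 < m by rewrite lt_min !divr_gt0.
  have : m <= m by []. rewrite {2}/m le_min => /andP[me mt].
  exists m; split=> //; [lra|lra|].
  move=> r r0 rm; have [->|rn0] := eqVneq r 0; first exact: ltW.
  apply/ltW; apply: eP; last by rewrite lt0r rn0.
  by rewrite -ball_normE /ball_/= sub0r normrN ger0_norm//; lra.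
apply: le_trans (caputo_ge a01 m0 mt cv Wv vle vm G0).
have -> : (2 * Gamma (1 - alpha))^-1 * d `^ (- alpha) * v t =
  (Gamma (1 - alpha))^-1 * (v t / 2 * d `^ (- alpha)) by rewrite invfM; ring.
rewrite ler_pM2l ?invr_gt0// ler_pM2l ?divr_gt0// !powRN.
have tm : 0 < t - m by rewrite subr_gt0.
by rewrite lef_pV2 ?posrE ?powR_gt0// ge0_ler_powR// ?nnegrE ltW.
Qed.
End exponential_maximum.

(** The factor of [v t] in the lower bound of the derivative of order [alpha]
    at a time [t] where [v] is maximal for the weight [expR (- (t / d))]. *)
Definition gain (R : realType) (alpha d : R) : R :=
  if alpha == 1 then (2 * d)^-1 else (2 * Gamma (1 - alpha))^-1 * d `^ (- alpha).

Lemma gain_unbounded (R : realType) (alpha L : R) : 0 < alpha -> alpha <= 1 -> 0 < L ->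
  \forall d \near (0 : R)^'+, L <= gain alpha d.
Proof.
move=> a0 a1 L0; rewrite /gain; case: eqP => [_|/eqP an1].
  have e0 : 0 < (2 * L)^-1 by rewrite invr_gt0 mulr_gt0.
  near=> d; have d0 : 0 < d by [].
  have dL : d <= (2 * L)^-1 by near: d; exact: nbhs_right_le.
  rewrite -[leLHS]invrK lef_pV2 ?posrE ?invr_gt0 ?mulr_gt0//.
  by rewrite -ler_pdivlMl// -invfM.
have {}a1 : alpha < 1 by rewrite lt_neqAle an1.
have G0 : 0 < Gamma (1 - alpha) by apply: Gamma_gt0; [rewrite subr_gt0|rewrite gerBl ltW].
have e0 : 0 < (2 * Gamma (1 - alpha) * L)^-1 by rewrite invr_gt0 !mulr_gt0.
near=> d; have d0 : 0 < d by [].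
have dL : d `^ alpha <= (2 * Gamma (1 - alpha) * L)^-1.
  near: d; have := @powR_cvg0 R alpha a0.
  by move=> /cvgr_le; apply.
rewrite powRN -[leLHS]invrK -invfM lef_pV2 ?posrE ?invr_gt0 ?mulr_gt0 ?powR_gt0//.
by rewrite -ler_pdivlMl ?mulr_gt0// -invfM.
Unshelve. all: by end_near. Qed.

Lemma Dt_ge_at_max (R : realType) (T alpha d t : R) (v : R -> R) :
  0 < alpha -> alpha <= 1 -> 0 < d -> 0 < t -> t <= T -> 0 < v t ->
  (forall s, 0 <= s -> s <= t -> v s <= expR (- ((t - s) / d)) * v t) ->
  v 0 <= 0 -> {within `[0, t], continuous v} ->
  (forall e, 0 < e -> e < t -> W1oo e t v) ->
  (alpha = 1 -> C1_time T v) ->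
  gain alpha d * v t <= Dt T alpha v t.
Proof.
move=> a0 a1 d0 t0 tT vt0 vmax v00 cv Wv C1v; rewrite /gain /Dt.
case: eqP => [/C1v C1|/eqP an1]; first exact: time_deriv_ge vmax C1.
by apply: caputo_ge_max => //; rewrite a0 lt_neqAle an1.
Qed.

(** * The maximum principle *)

Lemma near_forall_fin (T : Type) (I : finType) (F : set_system T) {FF : Filter F}
    (P : I -> T -> Prop) :
  (forall i, \forall x \near F, P i x) -> \forall x \near F, forall i, P i x.
Proof.
move=> FP; have : \forall x \near F, forall i, i \in enum I -> P i x.
  elim: (enum I) => [|j s IH]; first exact: filterE.
  apply: filterS2 (FP j) IH => x Pj Ps i.
  by rewrite inE => /predU1P[->|/Ps].
by apply: filterS => x Px i; apply: Px; rewrite mem_enum.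
Qed.

Lemma bounded_closure (R : realType) (V : normedModType R) (A : set V) :
  bounded_set A -> bounded_set (closure A).
Proof.
move=> [M [_ MA]]; exists (M + 2); split; first exact: num_real.
move=> N MN x clAx; have [y [Ay xy]] := clAx (ball x 1) (nbhsx_ballx x 1 ltr01).
have yM : `|y| <= M + 1 by apply: MA => //; rewrite ltrDl.
have {}xy : `|x - y| < 1 by move: xy; rewrite -ball_normE.
have := ler_normD (x - y) y; rewrite subrK => /=; lra.
Qed.

Unset Implicit Arguments.
Theorem mainTheorem6 (R : realType) (n : nat) (hn : (n.+1 <= 3)%N)
  (T : R) (hT : 0 < T)
  (l : nat) (alpha : 'I_l.+1 -> R)
  (halpha_pos : 0 < alpha ord_max)
  (halpha_decr : forall i j : 'I_l.+1, (i < j)%N -> alpha j < alpha i)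
  (halpha_le1 : alpha ord0 <= 1)
  (q : 'I_l.+1 -> R -> R)
  (hq_ge0 : forall i (t : R), t \in `[0, T] -> 0 <= q i t)
  (Cq : R) (hCq : 0 < Cq)
  (hq_sum : forall t : R, t \in `[0, T] -> Cq <= \sum_i q i t)
  (Omega : set 'rV[R]_n.+1) (hOmega : bounded_lipschitz_domain Omega)
  (a : 'rV[R]_n.+1 -> R -> 'M[R]_n.+1)
  (b : 'rV[R]_n.+1 -> R -> 'rV[R]_n.+1)
  (c : 'rV[R]_n.+1 -> R -> R)
  (ha_posdef : forall x (t : R), Omega x -> t \in `]0, T] -> sym_posdef (a x t))
  (ha_C1 : forall t : R, t \in `]0, T] ->
     forall i j, Ck 1 Omega (fun x => a x t i j))
  (hb_C : forall t : R, t \in `]0, T] -> forall i, Ck 0 Omega (fun x => b x t 0 i))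
  (hc_C : forall t : R, t \in `]0, T] -> Ck 0 Omega (fun x => c x t))
  (lambda : R) (hlambda : 0 <= lambda)
  (hc_lower : forall x (t : R), Omega x -> t \in `]0, T] -> - lambda <= c x t)
  (u : 'rV[R]_n.+1 -> R -> R)
  (hu_init : forall x, Omega x -> u x 0 <= 0)
  (hu_bdry : forall x (t : R), boundary Omega x -> t \in `[0, T] -> u x t <= 0)
  (hu_cont : {within closure Omega `*` `[0, T],
     continuous (fun z : 'rV[R]_n.+1 * R => u z.1 z.2)})
  (hu_C2 : forall t : R, t \in `]0, T] -> Ck 2 Omega (fun x => u x t))
  (hu_W1oo : forall x, Omega x ->
     forall e t : R, 0 < e -> e < t -> t <= T -> W1oo e t (u x))
  (hu_C1_time : alpha ord0 = 1 -> forall x, Omega x -> C1_time T (u x)) :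
  (forall x (t : R), Omega x -> t \in `]0, T] ->
     \sum_i q i t * Dt T (alpha i) (u x) t
     + elliptic_op a b u x t + c x t * u x t <= 0) ->
  forall x (t : R), closure Omega x -> t \in `[0, T] -> u x t <= 0.
Proof.
move=> hineq x0 t0 clx0 t0T; rewrite leNgt; apply/negP => u0.
have [neO oO _ bO _] := hOmega.
(* Chosen so that [Cq * L] exceeds [lambda]. *)
pose L := (lambda + Cq) / Cq.
have L0 : 0 < L by rewrite divr_gt0// ltr_wpDl.
have decr i : alpha ord_max <= alpha i.
  have [->|/eqP im] := eqVneq i ord_max; first by [].
  by apply/ltW/halpha_decr; rewrite ltn_neqAle -ltnS ltn_ord andbT; apply/eqP => /val_inj.
have a_gt0 i : 0 < alpha i := lt_le_trans halpha_pos (decr i).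
have a_lt1 i : i != ord0 -> alpha i < 1.
  move=> i0; apply: lt_le_trans halpha_le1; apply: halpha_decr.
  by rewrite lt0n.
have a_le1 i : alpha i <= 1.
  by have [->//|/a_lt1/ltW] := eqVneq i ord0.
have [d d0 dL] : exists2 d : R, 0 < d & forall i, L <= gain (alpha i) d.
  have near_L : \forall d \near (0 : R)^'+, forall i, L <= gain (alpha i) d.
    by apply: near_forall_fin => i; exact: gain_unbounded.
  have [d [d0 dL]] := filter_ex (filterI (nbhs_right_gt (0 : R)) near_L).
  by exists d.
pose K := closure Omega `*` `[0, T]%classic.
pose phi (z : 'rV[R]_n.+1 * R) := expR (- (z.2 / d)) * u z.1 z.2.
have K0 : K !=set0 by exists (x0, t0).
have cK : compact K.
  apply: compact_setX; last exact: segment_compact.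
  by apply: bounded_closed_compact; [exact: bounded_closure|exact: closed_closure].
have cphi : {within K, continuous phi}.
  move=> z; apply: cvgM; last exact: hu_cont.
  apply: (@continuous_subspaceT _ _ _ (fun z : 'rV[R]_n.+1 * R => expR (- (z.2 / d)))) => y.
  apply: (@continuous_comp _ _ _ (fun z : 'rV[R]_n.+1 * R => - (z.2 / d)) expR).
    by apply: cvgN; apply: cvgM; [exact: cvg_snd|exact: cvg_cst].
  exact: continuous_expR.
have [[xs ts] /set_mem [/= clxs tsT] phimax] := compact_EVT_max K0 cK cphi.
move: tsT; rewrite in_itv/= => /andP[ts0 tsT].
have us0 : 0 < u xs ts.
  have : phi (x0, t0) <= phi (xs, ts) by apply: phimax; rewrite inE.
  have : 0 < phi (x0, t0) by rewrite mulr_gt0 ?expR_gt0.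
  move=> /lt_le_trans /[apply]; by rewrite pmulr_rgt0 ?expR_gt0.
have Oxs : Omega xs.
  apply: contrapT => nO; have : u xs ts <= 0; last by rewrite leNgt us0.
  apply: hu_bdry; last by rewrite in_itv/= ts0.
  split=> //; move/interior_id : oO => oO'.
  by move=> ixs; apply: nO; rewrite -oO'.
have ts_gt0 : 0 < ts.
  rewrite lt_neqAle ts0 andbT; apply/eqP => E.
  by move: us0; rewrite -E ltNge hu_init.
have cu : {within `[0, T], continuous (u xs)}.
  apply/subspace_continuousP => s sT.
  move/subspace_continuousP : hu_cont => /(_ (xs, s) (conj clxs sT)) ucvg.
  apply: (@cvg_comp _ _ _ (fun r => (xs, r)) (fun z => u z.1 z.2) _ _ _ _ ucvg).
  move=> P /= [[A B] /= [nA nB] AB].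
  apply: filterS nB => r Br rT; apply: AB; last by split.
  by split=> //=; exact: nbhs_singleton.
have umax s : 0 <= s -> s <= ts -> u xs s <= expR (- ((ts - s) / d)) * u xs ts.
  move=> s0 sts; have : phi (xs, s) <= phi (xs, ts).
    by apply: phimax; rewrite inE; split=> //=; rewrite in_itv/= s0 (le_trans sts).
  rewrite /phi/= => H; rewrite mulrBl opprB expRD -mulrA.
  by rewrite -ler_pdivrMl ?expR_gt0// -expRN.
have DtL i : L * u xs ts <= Dt T (alpha i) (u xs) ts.
  apply: le_trans (Dt_ge_at_max (a_gt0 i) (a_le1 i) d0 ts_gt0 tsT us0 umax _ _ _ _).
  - by rewrite ler_wpM2r// ltW.
  - exact: hu_init.
  - by apply: continuous_subspaceW cu; apply: subset_itvl; rewrite bnd_simp.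
  - by move=> e e0 ets; apply: hu_W1oo.
  - move=> ai1; apply: hu_C1_time => //; have [<-//|/a_lt1] := eqVneq i ord0.
    by rewrite ai1 ltxx.
have tsin : ts \in `]0, T] by rewrite in_itv/= ts_gt0.
have tsin' : ts \in `[0, T] by rewrite in_itv/= ts0.
have ell : 0 <= elliptic_op a b u xs ts.
  apply: (elliptic_op_ge0_at_max (Omega := Omega)) => //.
  - exact: ha_posdef.
  - exact: ha_C1.
  - exact: hu_C2.
  - move=> y Oy; have : phi (y, ts) <= phi (xs, ts).
      by apply: phimax; rewrite inE; split=> //=; exact: subset_closure.
    by rewrite /phi/= ler_pM2l ?expR_gt0.
have := hineq xs ts Oxs tsin; apply/negP; rewrite -ltNge.
have qDt : Cq * (L * u xs ts) <= \sum_i q i ts * Dt T (alpha i) (u xs) ts.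
  apply: (@le_trans _ _ (\sum_i q i ts * (L * u xs ts))).
    by rewrite -mulr_suml ler_wpM2r ?hq_sum// mulr_ge0// ltW.
  by apply: ler_sum => i _; rewrite ler_wpM2l// hq_ge0.
have cu0 : - lambda * u xs ts <= c xs ts * u xs ts.
  by rewrite ler_wpM2r ?(ltW us0)// hc_lower.
have E : Cq * (L * u xs ts) = lambda * u xs ts + Cq * u xs ts.
  by rewrite /L mulrA mulrCA divff ?gt_eqF// mulr1 mulrDl.
have : 0 < Cq * u xs ts by rewrite mulr_gt0.
move: qDt ell cu0; rewrite E; move: (\sum_i _) (elliptic_op _ _ _ _ _) => S1 S2; lra.
Qed.
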